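(* For every integer $k\ge 2$, the graph $M_k$ (defined in the context) is a simple sphere triangulation with $|V(M_k)|=31k$.
   Context: A sphere triangulation is a graph embedded in the sphere so that every face is bounded by a triangle; the claim is that $M_k$ is a simple graph admitting such an embedding. The gadget $X$. Let $X$ be the simple graph on the $14$ vertices $a,b,c,d,e,f,g,h,i,j,k,l,m,n$ with neighbourhoods $N(a)=\{b,c,d,e,f,g\}$, $N(b)=\{a,g,h,i,j,c\}$, $N(c)=\{a,b,j,k,d\}$, $N(d)=\{a,c,k,l,e\}$, $N(e)=\{a,d,l,m,f\}$, $N(f)=\{a,e,m,i,h,g\}$, $N(g)=\{a,f,h,b\}$, $N(h)=\{b,g,f,i\}$, $N(i)=\{b,h,f,m,n,j\}$, $N(j)=\{b,i,n,k,c\}$, $N(k)=\{c,j,n,l,d\}$, $N(l)=\{d,k,n,m,e\}$, $N(m)=\{e,l,n,i,f\}$, $N(n)=\{i,m,l,k,j\}$. The seed $T$. The vertex set is $\{0,1,\dots,30\}$. The edges are the following. (1) The edges of the pentagonal bipyramid on $\{0,\dots,6\}$: the rim edges $01,12,23,34,40$ and all edges joining each of the two (nonadjacent) apices $5,6$ to each of $0,1,2,3,4$. (2) The edges of a first copy of $X$, obtained by mapping $g\mapsto 0$, $h\mapsto 1$ and $(a,b,c,d,e,f,i,j,k,l,m,n)\mapsto(7,8,9,10,11,12,13,14,15,16,17,18)$; the terminal edge $gh$ is identified with the existing edge $01$. (3) The edges of a second copy of $X$, obtained by mapping $g\mapsto 2$, $h\mapsto 3$ and $(a,b,c,d,e,f,i,j,k,l,m,n)\mapsto(19,20,21,22,23,24,25,26,27,28,29,30)$;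 the terminal edge $gh$ is identified with the existing edge $23$. (4) The two additional edges joining $6$ to $12$ and $6$ to $20$. Ports and annuli. In $T$ consider the ordered triangles $P=(0,4,6)$ and $R=(2,19,24)$. For disjoint ordered triangles $U=(u_0,u_1,u_2)$ and $V=(v_0,v_1,v_2)$, inserting the annulus between $U$ and $V$ means adding the six edges $u_0v_0,\ u_1v_0,\ u_1v_1,\ u_2v_1,\ u_2v_2,\ u_0v_2$. The graph $M_k$. For $k\ge2$ take disjoint labelled copies $T_1,\dots,T_k$ of $T$, and let $P_i,R_i$ be the copies of $P,R$ in $T_i$. For $1\le i\le k-2$, insert the annulus between $U=P_i$ and $V=R_{i+1}$. Insert the final annulus between $U=P_{k-1}$ and $V=P_k$. The resulting graph is $M_k$. *)

(* Defs.v *)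
From mathcomp Require Import all_boot all_order all_algebra.
From mathcomp Require Import all_classical all_reals all_analysis.
Import Order.TTheory GRing.Theory Num.Theory.
Import numFieldNormedType.Exports.

Set Implicit Arguments.
Unset Strict Implicit.
Unset Printing Implicit Defensive.

Local Open Scope classical_set_scope.
Local Open Scope nat_scope.

(* Graphs are multigraphs with an explicit type of edges, so that being simple
   is a genuine property.  The order of the two ends of an edge is only an
   encoding; the graphs are undirected. *)
Record graph := Graph {
  vertex : finType;
  edge : finType;
  ends : edge -> vertex * vertex }.

Definition joins (G : graph) (e : edge G) (x y : vertex G) : Prop :=
  ends e = (x, y) \/ ends e = (y, x).

Definition simple_graph (G : graph) : Prop :=
  (forall e : edge G, (ends e).1 <> (ends e).2) /\
  (forall (e f : edge G) (x y : vertex G), joins e x y -> joins f x y -> e = f).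

Definition sphere (R : realType) : set 'rV[R]_3 :=
  [set x : 'rV[R]_3 | \sum_(i < 3) x ord0 i ^+ 2 = 1]%R.
Arguments sphere : clear implicits.

(* [pt v] is the point representing v, and [arc e], restricted to [0, 1], is
   the curve representing e.  Since [pt] is injective, the last two clauses make
   [arc e] injective on [0, 1] whenever e is not a loop. *)
Record sphere_embedding (R : realType) (G : graph)
    (pt : vertex G -> 'rV[R]_3) (arc : edge G -> R -> 'rV[R]_3) : Prop := {
  pt_inj : injective pt;
  pt_sphere : forall v, sphere R (pt v);
  arc_continuous : forall e, {within `[0%R, 1%R], continuous (arc e)};
  arc_sphere : forall e, arc e @` `[0%R, 1%R] `<=` sphere R;
  arc_start : forall e, arc e 0%R = pt (ends e).1;
  arc_end : forall e, arc e 1%R = pt (ends e).2;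
  arc_avoids_pt : forall e v s, (0 < s < 1)%R -> arc e s <> pt v;
  arc_disjoint : forall e f s t, (0 < s < 1)%R -> (0 < t < 1)%R ->
    arc e s = arc f t -> e = f /\ s = t }.

Definition drawing (R : realType) (G : graph)
    (pt : vertex G -> 'rV[R]_3) (arc : edge G -> R -> 'rV[R]_3) :
    set 'rV[R]_3 :=
  range pt `|` \bigcup_(e in [set: edge G]) (arc e @` `[0%R, 1%R]).

Definition face (R : realType) (G : graph)
    (pt : vertex G -> 'rV[R]_3) (arc : edge G -> R -> 'rV[R]_3)
    (F : set 'rV[R]_3) : Prop :=
  exists2 x, (sphere R `\` drawing pt arc) x &
    F = connected_component (sphere R `\` drawing pt arc) x.

(* The topological boundary of F as a subset of the sphere. *)
Definition sphere_boundary (R : realType) (F : set 'rV[R]_3) : set 'rV[R]_3 :=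
  sphere R `&` closure F `&` closure (sphere R `\` F).

Definition bounded_by_triangle (R : realType) (G : graph)
    (arc : edge G -> R -> 'rV[R]_3) (F : set 'rV[R]_3) : Prop :=
  exists (x y z : vertex G) (e1 e2 e3 : edge G),
    [/\ uniq [:: x; y; z], joins e1 x y, joins e2 y z, joins e3 z x &
        sphere_boundary F = arc e1 @` `[0%R, 1%R] `|` arc e2 @` `[0%R, 1%R]
                              `|` arc e3 @` `[0%R, 1%R]].

Definition sphere_triangulation (R : realType) (G : graph) : Prop :=
  exists (pt : vertex G -> 'rV[R]_3) (arc : edge G -> R -> 'rV[R]_3),
    sphere_embedding pt arc /\
    (forall F, face pt arc F -> bounded_by_triangle arc F).

(* The vertices a, ..., n of the gadget X are numbered 0, ..., 13. *)
Definition X_nbhd : seq (seq nat) :=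
  let a := 0 in let b := 1 in let c := 2 in let d := 3 in let e := 4 in
  let f := 5 in let g := 6 in let h := 7 in let i := 8 in let j := 9 in
  let k := 10 in let l := 11 in let m := 12 in let n := 13 in
  [:: [:: b; c; d; e; f; g];
      [:: a; g; h; i; j; c];
      [:: a; b; j; k; d];
      [:: a; c; k; l; e];
      [:: a; d; l; m; f];
      [:: a; e; m; i; h; g];
      [:: a; f; h; b];
      [:: b; g; f; i];
      [:: b; h; f; m; n; j];
      [:: b; i; n; k; c];
      [:: c; j; n; l; d];
      [:: d; k; n; m; e];
      [:: e; l; n; i; f];
      [:: i; m; l; k; j] ].

(* Each edge is listed once, from its smaller to its larger end. *)
Definition X_edges : seq (nat * nat) :=
  [seq (u, v) | u <- iota 0 14, v <- [seq v <- nth [::] X_nbhd u | u < v]].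

(* The edges of a copy of X, except for its terminal edge gh = (6, 7): that edge
   is identified with an already present one.  The list [img] gives the images
   of a, ..., n. *)
Definition X_copy (img : seq nat) : seq (nat * nat) :=
  [seq (nth 0 img e.1, nth 0 img e.2) | e <- X_edges & e != (6, 7)].

Definition bipyramid_edges : seq (nat * nat) :=
  [:: (0, 1); (1, 2); (2, 3); (3, 4); (4, 0)] ++
  [seq (p, r) | p <- [:: 5; 6], r <- [:: 0; 1; 2; 3; 4]].

Definition T_edges : seq (nat * nat) :=
  bipyramid_edges ++
  X_copy [:: 7; 8; 9; 10; 11; 12; 0; 1; 13; 14; 15; 16; 17; 18] ++
  X_copy [:: 19; 20; 21; 22; 23; 24; 2; 3; 25; 26; 27; 28; 29; 30] ++
  [:: (6, 12); (6, 20)].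

Definition T_ends (e : 'I_(size T_edges)) : 'I_31 * 'I_31 :=
  let uv := tnth (in_tuple T_edges) e in (inord uv.1, inord uv.2).

Definition T : graph := Graph T_ends.

Definition port_P : 'I_31 * 'I_31 * 'I_31 := (inord 0, inord 4, inord 6).
Definition port_R : 'I_31 * 'I_31 * 'I_31 := (inord 2, inord 19, inord 24).

Definition annulus (V : Type) (U W : V * V * V) : 6.-tuple (V * V) :=
  let: (u0, u1, u2) := U in
  let: (v0, v1, v2) := W in
  [tuple (u0, v0); (u1, v0); (u1, v1); (u2, v1); (u2, v2); (u0, v2)].

Definition in_copy (k : nat) (i : 'I_k) (U : 'I_31 * 'I_31 * 'I_31) :
    ('I_k * 'I_31) * ('I_k * 'I_31) * ('I_k * 'I_31) :=
  let: (u0, u1, u2) := U in ((i, u0), (i, u1), (i, u2)).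

(* Copies are numbered 0, ..., k - 1; annulus number i < k - 1 joins copies i
   and i + 1. *)
Definition this_copy (k : nat) (i : 'I_k.-1) : 'I_k := widen_ord (leq_pred k) i.

Lemma next_copy_subproof (k : nat) (i : 'I_k.-1) : i.+1 < k.
Proof. by rewrite -ltn_predRL ltn_ord. Qed.

Definition next_copy (k : nat) (i : 'I_k.-1) : 'I_k :=
  Ordinal (next_copy_subproof i).

Definition M_annulus (k : nat) (i : 'I_k.-1) :
    6.-tuple (('I_k * 'I_31) * ('I_k * 'I_31)) :=
  annulus (in_copy (this_copy i) port_P)
          (in_copy (next_copy i) (if i.+2 == k then port_P else port_R)).

Definition M_ends (k : nat)
    (e : ('I_k * edge T) + ('I_k.-1 * 'I_6)) :
    ('I_k * 'I_31) * ('I_k * 'I_31) :=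
  match e with
  | inl (i, e) => ((i, (T_ends e).1), (i, (T_ends e).2))
  | inr (i, j) => tnth (M_annulus i) j
  end.

Definition M (k : nat) : graph := Graph (@M_ends k).

(* Main.v *)
(* The sphere is cut along rays.  All vertices are vectors of the closed octant
   of R^3, an edge is the radial projection to the sphere of the segment between
   its ends, and a triangle is the projection of the cone over its vertices; the
   last face, bounded by the triangle of the standard basis vectors, is the
   complement of the octant.  It therefore suffices that every vector of the
   octant is, in exactly one way, a nonnegative combination of the vertices of a
   triangle of the complex (a "fan").

   A finite complex is a fan as soon as its vertices carry heights such that,
   for each triangle f, the linear functional n_f matching the heights on f is
   strictly below the heights of the other vertices: the triangle containing x
   is then the one maximizing n_f(x).  This is checked by integer computation
   for two complexes: T without the face R and with the annulus and the triangle
   of the next copy inserted in P (the block), and T without the face P (the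
   cap).  Replacing a triangle of a fan by the linear image of another fan gives
   a fan, so M_k is obtained by nesting k - 1 blocks and one cap. *)

Require Import Defs.
From Stdlib Require Import ZArith.
From mathcomp Require Import all_boot all_order all_algebra.
From mathcomp Require Import all_classical all_reals all_analysis.
From mathcomp Require Import ssrZ zify lra.
Import Order.TTheory GRing.Theory Num.Theory.
Import numFieldNormedType.Exports.

Set Implicit Arguments.
Unset Strict Implicit.
Unset Printing Implicit Defensive.

Local Open Scope classical_set_scope.
Local Open Scope ring_scope.

(** * Fans *)

Section Fan.
Variables (R : realFieldType) (V : finType).
Implicit Types (p : V -> 'rV[R]_3) (f g o : 3.-tuple V) (c d x : 'rV[R]_3).
Implicit Types (K : 3.-tuple V -> Prop).

Definition nneg x := forall j, 0 <= x 0 j.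

Definition comb p f c : 'rV[R]_3 := \sum_j c 0 j *: p (tnth f j).

Definition weight f c (v : V) : R := \sum_(j | tnth f j == v) c 0 j.

(* Combinations are compared through their weights on the vertices: a vector
   on a common side of two triangles has the same weights in both. *)
Record fan o K p : Prop := {
  fan_uniq : forall f, K f -> uniq f;
  fan_cover : forall x, nneg x ->
    exists2 f, K f & exists2 c, nneg c & x = comb p f c;
  fan_sep : forall f g c d, K f -> K g -> nneg c -> nneg d ->
    comb p f c = comb p g d -> weight f c =1 weight g d;
  fan_corner : forall j, p (tnth o j) = delta_mx 0 j;
  fan_interior : forall f v, K f -> v \in f -> v \notin o ->
    forall j, 0 < p v 0 j }.

Lemma fan_eq o K K' p : (forall f, K f <-> K' f) -> fan o K p -> fan o K' p.
Proof.
by move=> KK' FK; rewrite (_ : K' = K)// funeqE => f; rewrite propeqE;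
  split=> /KK'.
Qed.

Lemma weight_out f c v : v \notin f -> weight f c v = 0.
Proof.
move=> vf; rewrite /weight big_pred0// => j; apply: contraNF vf => /eqP<-.
exact: mem_tnth.
Qed.

Lemma weight_tnth f c j : uniq f -> weight f c (tnth f j) = c 0 j.
Proof.
by move=> /tuple_uniqP/inj_eq inj_f; rewrite /weight (big_pred1 j)// => i /=.
Qed.

Lemma comb_weight p f c : comb p f c = \sum_v weight f c v *: p v.
Proof.
rewrite /comb (partition_big (tnth f) predT)//=; apply: eq_bigr => v _.
by rewrite scaler_suml; apply: eq_bigr => j /eqP->.
Qed.

Lemma comb_mul p p' f c A :
    (forall v, v \in f -> p v = p' v *m A) -> comb p f c = comb p' f c *m A.
Proof.
move=> pA; rewrite /comb mulmx_suml; apply: eq_bigr => j _.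
by rewrite pA ?mem_tnth// scalemxAl.
Qed.

Lemma comb_rows p f c : comb p f c = c *m \matrix_j p (tnth f j).
Proof. by rewrite mulmx_sum_row; apply: eq_bigr => j _; rewrite rowK. Qed.

Lemma comb_nneg p f c :
  (forall v, v \in f -> nneg (p v)) -> nneg c -> nneg (comb p f c).
Proof.
move=> p0 c0 j; rewrite summxE; apply: sumr_ge0 => i _.
by rewrite mxE mulr_ge0//; apply: p0; rewrite mem_tnth.
Qed.

Lemma fan_nneg o K p f v : fan o K p -> K f -> v \in f -> nneg (p v).
Proof.
move=> FK Kf vf j; have [/tnthP[i ->]|vo] := boolP (v \in o).
  by rewrite (fan_corner FK) mxE ler0n.
exact/ltW/(fan_interior FK Kf vf vo).
Qed.

(** Replaces the triangle [t] by the image of the fan [K'] under the linear map sending the standard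
    basis to the corners of [t]. Since each [f] of [K0] misses a corner of [t], its overlap with [t]
    stays on a side of [t]; a corner of [t] outside [o] keeps the new vertices strictly positive. *)
Lemma fan_glue o t K0 K' p p' :
    fan o (fun f => K0 f \/ f = t) p -> fan t K' p' ->
    (forall f, K0 f -> exists j, tnth t j \notin f) ->
    (exists j, tnth t j \notin o) ->
    (forall f g v, K0 f -> K' g -> v \in f -> v \in g -> v \in t) ->
    (forall f v, K' f -> v \in f -> p v = p' v *m \matrix_j p (tnth t j)) ->
  fan o (fun f => K0 f \/ K' f) p.
Proof.
move=> FK FK' missK0 [jo tjo] shared pp'.
have Kt : K0 t \/ t = t by right.
have ut : uniq t by apply: (fan_uniq FK).
have pcomb g d : K' g -> comb p g d = comb p t (comb p' g d).
  by move=> K'g; rewrite [RHS]comb_rows; apply: comb_mul => v vg; apply: pp' vg.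
have nn' g d : K' g -> nneg d -> nneg (comb p' g d).
  by move=> K'g; apply: comb_nneg => v vg; apply: fan_nneg FK' K'g vg.
(* A vector of [t] that also lies in a triangle [f] of [K0] has weight 0 at a
   corner of [t], so it is a combination of the other corners both in [f] and
   in [g], whose remaining vertices are interior to [t]. *)
have mixed f g c d : K0 f -> K' g -> nneg c -> nneg d ->
    comb p f c = comb p g d -> weight f c =1 weight g d.
  move=> K0f K'g c0 d0; rewrite (pcomb g)// => eqcd.
  have wt : weight f c =1 weight t (comb p' g d).
    by apply: (fan_sep FK) => //; [left|apply: nn'].
  have [j tjf] := missK0 _ K0f.
  have ej : comb p' g d 0 j = 0.
    by rewrite -(weight_tnth (comb p' g d) j ut) -wt weight_out.
  have gt l : d 0 l != 0 -> tnth g l \in t.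
    move=> dl; apply/negPn/negP => glt.
    have pl := fan_interior FK' K'g (mem_tnth l g) glt j.
    move: ej; rewrite summxE => /eqP; rewrite psumr_eq0; last first.
      move=> i _; rewrite mxE mulr_ge0//.
      exact: fan_nneg FK' K'g (mem_tnth _ _) _.
    move=> /allP/(_ l (mem_index_enum _)); rewrite mxE mulf_eq0 (negPf dl)/=.
    by rewrite gt_eqF.
  move=> v; rewrite wt; have [/tnthP[i ->]|vt] := boolP (v \in t); last first.
    rewrite weight_out//; apply/esym/big1 => l /eqP glv.
    by apply/eqP; apply: contraNT vt => /gt; rewrite glv.
  rewrite weight_tnth// summxE /weight [RHS]big_mkcond; apply: eq_bigr => l _.
  rewrite mxE; have [->|/gt/tnthP[m gm]] := eqVneq (d 0 l) 0.
    by rewrite mul0r; case: ifP.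
  rewrite gm (fan_corner FK') mxE eqxx/= (inj_eq (tuple_uniqP _ ut)) eq_sym.
  by case: eqP; rewrite (mulr1, mulr0).
split.
- by move=> f [K0f|K'f]; [apply: (fan_uniq FK); left|apply: (fan_uniq FK')].
- move=> x /(fan_cover FK)[f [K0f|->]] [c c0 ->].
    by exists f; [left|exists c].
  have [g K'g [d d0 cd]] := fan_cover FK' c0.
  by exists g; [right|exists d => //; rewrite (pcomb g)// -cd].
- move=> f g c d [K0f|K'f] [K0g|K'g] c0 d0 eqcd.
  + by apply: (fan_sep FK) => //; left.
  + exact: mixed.
  + by move=> v; apply/esym/mixed.
  (* Both vectors lie in [t]; equal weights there give equal vectors before the linear map, where
     [fan_sep] of [K'] applies. *)
  + apply: (fan_sep FK') => //; apply/rowP => j.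
    rewrite -!(weight_tnth _ j ut); apply: (fan_sep FK) => //; try exact: nn'.
    by rewrite -!pcomb.
- exact: fan_corner FK.
- move=> f v [K0f|K'f] vf vo j.
    by apply: (fan_interior FK _ vf vo); left.
  have [/tnthP[i vi]|vt] := boolP (v \in t).
    by apply: (fan_interior FK Kt _ vo); rewrite vi mem_tnth.
  (* A vertex interior to [t] has a positive coefficient at the corner [jo] outside [o], whose
     coordinates are positive; the other terms are nonnegative. *)
  rewrite (pp' _ _ K'f vf) mxE (bigD1 jo)//=; apply: ltr_wpDr.
    apply: sumr_ge0 => i _; rewrite mxE mulr_ge0//.
      exact: fan_nneg FK' K'f vf _.
    exact: fan_nneg FK Kt (mem_tnth _ _) _.
  rewrite mxE mulr_gt0//; first exact: (fan_interior FK' K'f vf vt).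
  exact: (fan_interior FK Kt (mem_tnth _ _) tjo).
Qed.

(* The functional [n f] agrees with the heights [h] on the vertices of [f] and
   lies below them elsewhere, so the triangle containing [x] is the one whose
   functional is largest at [x]. *)
Lemma fan_of_lifting o (s : seq (3.-tuple V)) p (h : V -> R)
    (n : 3.-tuple V -> 'cV[R]_3) :
    s != [::] ->
    (forall f, f \in s -> uniq f) ->
    (forall f, f \in s -> \matrix_j p (tnth f j) \in unitmx) ->
    (forall f v, f \in s -> v \in f -> (p v *m n f) 0 0 = h v) ->
    (forall f g v, f \in s -> g \in s -> v \in g -> v \notin f ->
      (p v *m n f) 0 0 < h v) ->
    (forall f j, f \in s ->
      (exists2 g, g \in s & tnth f j \notin g /\
         forall i, i != j -> tnth f i \in g) \/
      (exists2 m, 0 < p (tnth f j) 0 m &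
         forall i, i != j -> p (tnth f i) 0 m = 0)) ->
    (forall j, p (tnth o j) = delta_mx 0 j) ->
    (forall f v, f \in s -> v \in f -> v \notin o -> forall j, 0 < p v 0 j) ->
  fan o (fun f => f \in s) p.
Proof.
move=> s0 us unit_s on off adj corner interior.
have val f g c : (comb p g c *m n f) 0 0 =
    \sum_j c 0 j * (p (tnth g j) *m n f) 0 0.
  by rewrite mulmx_suml summxE; apply: eq_bigr => j _; rewrite -scalemxAl mxE.
have le_h f g v : f \in s -> g \in s -> v \in g -> (p v *m n f) 0 0 <= h v.
  move=> fs gs vg; have [vf|vf] := boolP (v \in f); first by rewrite on.
  exact/ltW/(off _ g).
have valf f c : f \in s -> (comb p f c *m n f) 0 0 =
    \sum_j c 0 j * h (tnth f j).
  by move=> fs; rewrite val; apply: eq_bigr => j _; rewrite on// mem_tnth.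
have val_le f g c : f \in s -> g \in s -> nneg c ->
    (comb p g c *m n f) 0 0 <= (comb p g c *m n g) 0 0.
  move=> fs gs c0; rewrite valf// val; apply: ler_sum => j _.
  by rewrite ler_wpM2l// (le_h _ g)// mem_tnth.
have val_eq f g c : f \in s -> g \in s -> nneg c ->
    (comb p g c *m n f) 0 0 = (comb p g c *m n g) 0 0 ->
    forall j, c 0 j != 0 -> tnth g j \in f.
  move=> fs gs c0 eqv j cj; apply/negPn/negP => gjf.
  suff: (comb p g c *m n f) 0 0 < (comb p g c *m n g) 0 0 by rewrite eqv ltxx.
  rewrite valf// val (bigD1 j)//= [ltRHS](bigD1 j)//=; apply: ltr_leD.
    by rewrite ltr_pM2l ?lt0r ?cj ?c0// (off _ g)// mem_tnth.
  by apply: ler_sum => i _; rewrite ler_wpM2l// (le_h _ g)// mem_tnth.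
split => //.
- move=> x x0; case: s s0 => // f0 s' _ in us unit_s on off adj interior val
    le_h valf val_le val_eq *.
  set s := f0 :: s' in us unit_s on off adj interior val le_h valf val_le
    val_eq *.
  have f0s : f0 \in s by rewrite mem_head.
  case: (@arg_maxP _ _ _ f0 (fun f => f \in s) (fun f => (x *m n f) 0 0) f0s).
  move=> f fs fmax.
  exists f => //; pose c := x *m invmx (\matrix_j p (tnth f j)).
  have xc : x = comb p f c by rewrite comb_rows mulmxKV// unit_s.
  (* If the coordinate at corner [j] were negative, the triangle across the opposite side would have
     a larger functional at [x], against the choice of [f]. If instead that side lies in a
     coordinate plane, [x] would leave the octant. *)
  exists c => // j; rewrite leNgt; apply/negP => cj.
  have [[g gs [fjg fig]]|[m pm p0]] := adj f j fs.
    have := fmax g gs; rewrite /= leNgt => /negP; apply.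
    rewrite xc valf// val (bigD1 j)//= [ltRHS](bigD1 j)//=; apply: ltr_leD.
      by rewrite ltr_nM2l// (off _ f)// mem_tnth.
    rewrite le_eqVlt; apply/orP; left; apply/eqP; apply: eq_bigr => i ij.
    by rewrite on// fig.
  have := x0 m; rewrite xc summxE (bigD1 j)//= big1 ?addr0; last first.
    by move=> i ij; rewrite mxE p0// mulr0.
  by rewrite mxE leNgt nmulr_rlt0// pm.
- move=> f g c d fs gs c0 d0 eqcd.
  (* Both functionals take the same value at the common vector, and [n f] is strictly lower at
     vertices of [g] outside [f], so only vertices of [f] can carry weight in [g]. *)
  have eqn : (comb p g d *m n f) 0 0 = (comb p g d *m n g) 0 0.
    by apply/eqP; rewrite eq_le val_le//= -eqcd val_le.
  pose e : 'rV[R]_3 := \row_j weight g d (tnth f j).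
  have gf := val_eq _ _ _ fs gs d0 eqn.
  have wv v : v \notin f -> weight g d v = 0.
    move=> vf; apply: big1 => j /eqP gj; apply/eqP.
    by apply: contraNT vf => /gf; rewrite gj.
  have we : weight f e =1 weight g d.
    move=> v; have [/tnthP[j ->]|vf] := boolP (v \in f).
      by rewrite weight_tnth ?us// mxE.
    by rewrite wv// weight_out.
  have : comb p f c = comb p f e.
    by rewrite eqcd !comb_weight; apply: eq_bigr => v _; rewrite we.
  rewrite !comb_rows => /(can_inj (mulmxK (unit_s _ fs))) -> v.
  exact: we.
Qed.

End Fan.

(** * Integer certificates *)

Definition corners (T : Type) (t : T * T * T) : seq T := [:: t.1.1; t.1.2; t.2].

Definition triangle (T : Type) (phi : nat -> T) (t : nat * nat * nat) :
  3.-tuple T := [tuple phi t.1.1; phi t.1.2; phi t.2].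

Lemma tnth_triangle (T : Type) (phi : nat -> T) t j :
  tnth (triangle phi t) j = phi (nth 0%N (corners t) j).
Proof. by case: j => [[|[|[|]]]]. Qed.

Lemma mem_triangle (T : eqType) (phi : nat -> T) t v :
  (v \in triangle phi t) = (v \in map phi (corners t)).
Proof. by []. Qed.

Lemma mem_corners t (j : 'I_3) : nth 0%N (corners t) j \in corners t.
Proof. by rewrite mem_nth. Qed.

Definition Zdot (a b : Z * Z * Z) : Z :=
  a.1.1 * b.1.1 + a.1.2 * b.1.2 + a.2 * b.2.

Definition Zcross (a b : Z * Z * Z) : Z * Z * Z :=
  (a.1.2 * b.2 - a.2 * b.1.2, a.2 * b.1.1 - a.1.1 * b.2,
   a.1.1 * b.1.2 - a.1.2 * b.1.1).

Definition Zcomb (h a b c : Z * Z * Z) : Z * Z * Z :=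
  (h.1.1 * a.1.1 + h.1.2 * b.1.1 + h.2 * c.1.1,
   h.1.1 * a.1.2 + h.1.2 * b.1.2 + h.2 * c.1.2,
   h.1.1 * a.2 + h.1.2 * b.2 + h.2 * c.2).

Definition forall3 (P : pred nat) : bool := [&& P 0%N, P 1%N & P 2%N].

Lemma forall3P P (j : 'I_3) : forall3 P -> P j.
Proof. by case: j => [[|[|[|]]]]//= _ /and3P[]. Qed.

Section Certificate.
Variables (pts : seq (Z * Z * Z)) (hts : seq Z).
Variables (s : seq (nat * nat * nat)) (o : nat * nat * nat).

Definition Zpt (v : nat) := nth (0, 0, 0) pts v.
Definition Zht (v : nat) := nth 0 hts v.
Definition Zcoord (v j : nat) : Z := (corners (Zpt v))`_j.

(** The basis dual to the corners of [t], multiplied by their determinant. *)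
Definition Zdual (t : nat * nat * nat) (j : nat) : Z * Z * Z :=
  let a := Zpt t.1.1 in let b := Zpt t.1.2 in let c := Zpt t.2 in
  nth (0, 0, 0) [:: Zcross b c; Zcross c a; Zcross a b] j.

Definition Zdet (t : nat * nat * nat) : Z := Zdot (Zpt t.1.1) (Zdual t 0).

Definition Znormal (t : nat * nat * nat) : Z * Z * Z :=
  Zcomb (Zht t.1.1, Zht t.1.2, Zht t.2) (Zdual t 0) (Zdual t 1) (Zdual t 2).

(** The dual-basis identities are tested numerically instead of being proved by algebra; they
    provide the inverse of the matrix of corners. *)
Definition nondegenerate t :=
  [&& uniq (corners t), all (gtn (size pts)) (corners t), Zdet t != 0 &
    forall3 (fun i => forall3 (fun j =>
      Zdot (Zpt (nth 0%N (corners t) i)) (Zdual t j)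
        == if i == j then Zdet t else 0))].

(* The functional matching the heights on [t] is [Znormal t] divided by
   [Zdet t]; the inequality is multiplied by [Zdet t ^+ 2], so that the
   orientation of [t] does not matter. *)
Definition supports t :=
  all (fun v => let d := Zdet t in let x := Zdot (Zpt v) (Znormal t) in
    if v \in corners t then x == d * Zht v
    else d * x < d * d * Zht v) (iota 0 (size pts)).

(* The side of [t] opposite to its corner [j] belongs to another triangle or
   lies in a coordinate plane. *)
Definition opposite_ok t j :=
  let c := nth 0%N (corners t) in
  has (fun g => (c j \notin corners g) &&
    forall3 (fun i => (i == j) || (c i \in corners g))) s
  || has (fun m => (0 < Zcoord (c j) m) &&
    forall3 (fun i => (i == j) || (Zcoord (c i) m == 0))) (iota 0 3).

Definition lifting_certificate :=
  [&& s != [::],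
    all (fun t => [&& nondegenerate t, supports t & forall3 (opposite_ok t)]) s,
    all (gtn (size pts)) (corners o),
    forall3 (fun i => forall3 (fun j => Zcoord (nth 0%N (corners o) i) j
       == if i == j then 1 else 0)) &
    all (fun v => (v \in corners o) || forall3 (fun j => 0 < Zcoord v j))
      (iota 0 (size pts))].

Variables (R : realFieldType) (V : finType) (phi : nat -> V).

(** Certificates are evaluated in the binary integers [Z], which suit [vm_compute]; the fan itself
    lives over [R]. *)
Definition Zr (z : Z) : R := (int_of_Z z)%:~R.

Definition Zrow (a : Z * Z * Z) : 'rV[R]_3 := \row_j Zr (corners a)`_j.

Lemma ZrD a b : Zr (a + b) = Zr a + Zr b.
Proof. by rewrite /Zr !rmorphD. Qed.

Lemma ZrM a b : Zr (a * b) = Zr a * Zr b.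
Proof. by rewrite /Zr !rmorphM. Qed.

Lemma Zr_lt a b : (Zr a < Zr b) = (a < b).
Proof. by rewrite /Zr ltr_int; lia. Qed.

Lemma Zr_eq0 a : (Zr a == 0) = (a == 0).
Proof. by rewrite /Zr intr_eq0; lia. Qed.

Lemma Zrow_dot a b : (Zrow a *m (Zrow b)^T) 0 0 = Zr (Zdot a b).
Proof. by rewrite mxE !big_ord_recr big_ord0 /= !mxE add0r !ZrD !ZrM. Qed.

(** Turns one boolean computation into a fan for any naming [phi] of the indices, so that the block
    certificate serves every copy. Injectivity of [phi] lets membership in a face be tested on
    numbers. *)
Lemma fan_of_certificate (p : V -> 'rV[R]_3) :
    lifting_certificate -> {in gtn (size pts) &, injective phi} ->
    (forall v, (v < size pts)%N -> p (phi v) = Zrow (Zpt v)) ->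
  fan (triangle phi o) (fun f => f \in [seq triangle phi t | t <- s]) p.
Proof.
move=> /and5P[s0 /allP tok /allP oN ounit /allP interior] phi_inj pphi.
have Zr0 : Zr 0 = 0 by [].
have inN t v : t \in s -> v \in corners t -> (v < size pts)%N.
  by move=> /tok /and3P[/and4P[_ /allP tN _ _] _ _] /tN.
have mem_phi v t : t \in s -> (v < size pts)%N ->
    (phi v \in triangle phi t) = (v \in corners t).
  move=> ts vN; rewrite mem_triangle; apply/mapP/idP => [[u ut /phi_inj->//]|].
    exact: inN ut.
  by move=> vt; exists v.
have mem_phio v : (v < size pts)%N ->
    (phi v \in triangle phi o) = (v \in corners o).
  move=> vN; rewrite mem_triangle; apply/mapP/idP => [[u ut /phi_inj->//]|].
    exact: oN.
  by move=> vt; exists v.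
have inNj t (j : 'I_3) : t \in s -> (nth 0%N (corners t) j < size pts)%N.
  by move=> ts; rewrite (inN t)// mem_corners.
have pt t (j : 'I_3) : t \in s ->
    p (tnth (triangle phi t) j) = Zrow (Zpt (nth 0%N (corners t) j)).
  by move=> ts; rewrite tnth_triangle pphi// inNj.
have det0 t : t \in s -> Zr (Zdet t) != 0.
  by move=> /tok /and3P[/and4P[_ _ + _] _ _]; rewrite Zr_eq0.
(* [tof], and [vof] below, recover index triples and indices, since functionals and heights must be
   functions of tuples and vertices. *)
pose tof f := nth (0, 0, 0)%N s (index f [seq triangle phi t | t <- s]).
have tofP f : f \in [seq triangle phi t | t <- s] ->
    tof f \in s /\ f = triangle phi (tof f).
  move=> fs; have := fs; rewrite -index_mem size_map => ls; split.
    exact: mem_nth.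
  by rewrite /tof -(nth_map _ f)// nth_index.
pose vof v := index v [seq phi u | u <- iota 0 (size pts)].
have vofK v : (v < size pts)%N -> vof (phi v) = v.
  move=> vN; rewrite /vof.
  have {1}-> : phi v = nth (phi 0%N) [seq phi u | u <- iota 0 (size pts)] v.
    by rewrite (nth_map 0%N) ?size_iota// nth_iota.
  rewrite index_uniq ?size_map ?size_iota// map_inj_in_uniq ?iota_uniq//.
  by move=> a b; rewrite !mem_iota; apply: phi_inj.
pose h v := Zr (Zht (vof v)).
pose n f := (Zr (Zdet (tof f)))^-1 *: (Zrow (Znormal (tof f)))^T.
have mapne : [seq triangle phi t | t <- s] != [::].
  by case: (s) s0.
have pn f v : (v < size pts)%N -> (p (phi v) *m n f) 0 0 =
    (Zr (Zdet (tof f)))^-1 * Zr (Zdot (Zpt v) (Znormal (tof f))).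
  by move=> vN; rewrite pphi// -scalemxAr mxE Zrow_dot.
have inI v : (v < size pts)%N -> v \in iota 0 (size pts) by rewrite mem_iota.
have val f v : f \in [seq triangle phi t | t <- s] -> (v < size pts)%N ->
    if v \in corners (tof f) then (p (phi v) *m n f) 0 0 = h (phi v)
    else (p (phi v) *m n f) 0 0 < h (phi v).
  move=> /tofP[ts _] vN; have d0 := det0 _ ts.
  have /and3P[_ /allP/(_ v (inI v vN)) + _] := tok _ ts.
  rewrite pn// /h vofK//; case: ifP => _.
    by move/eqP ->; rewrite ZrM mulKf.
  rewrite -Zr_lt !ZrM -mulrA => lt_d;
    rewrite -(ltr_pM2l (x := Zr (Zdet (tof f)) ^+ 2)).
    by rewrite mulrA expr2 mulfK// -mulrA.
  by rewrite exprn_even_gt0.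
have vertex f v : f \in [seq triangle phi t | t <- s] -> v \in f ->
    exists2 u, v = phi u & u \in corners (tof f) /\ (u < size pts)%N.
  move=> /tofP[ts {1}->]; rewrite mem_triangle => /mapP[u ut ->].
  by exists u => //; rewrite (inN (tof f)).
apply: (fan_of_lifting (h := h) (n := n)) => //.
- move=> f /tofP[ts ->]; rewrite /= !inE.
  have /and3P[/and4P[+ _ _ _] _ _] := tok _ ts.
  rewrite /= !inE !andbT !negb_or => /andP[/andP[n12 n13] n23].
  have inj := inj_in_eq phi_inj.
  by rewrite !inj ?n12 ?n13// ?inE; apply: (inN (tof f)) => //;
    rewrite !inE eqxx ?orbT.
- move=> f /tofP[ts ->]; set t := tof f in ts *.
  have /and3P[/and4P[_ _ _ dual] _ _] := tok _ ts.
  (* The columns of [C] are the dual vectors, so [C] divided by the determinant inverts the matrix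
     of corners. *)
  pose C := \matrix_(i < 3, j < 3) Zrow (Zdual t j) 0 i.
  have /mulmx1_unit[]// : \matrix_j p (tnth (triangle phi t) j) *m ((Zr (Zdet
    t))^-1 *: C) = 1%:M.
  rewrite -scalemxAr; apply/matrixP => i j; rewrite !mxE.
  have -> : \sum_k (\matrix_j p (tnth (triangle phi t) j)) i k * C k j =
      (Zrow (Zpt (nth 0%N (corners t) i)) *m (Zrow (Zdual t j))^T) 0 0.
    by rewrite [RHS]mxE; apply: eq_bigr => k _;
      rewrite [X in X * _]mxE [C _ _]mxE [X in _ = _ * X]mxE pt.
  have /eqP := forall3P j (forall3P i dual).
  rewrite Zrow_dot => ->; case: eqP => [/ord_inj ->|ij].
    by rewrite eqxx mulVf// det0.
  by rewrite Zr0 mulr0 (_ : (i == j) = false)//; apply/eqP => eqij; case: ij;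
    rewrite eqij.
- move=> f v fs /(vertex _ _ fs)[u -> [ut uN]].
  by have := val f u fs uN; rewrite ut.
- move=> f g v fs gs /(vertex _ _ gs)[u -> [ut uN]].
  have [ts ef] := tofP _ fs.
  by rewrite {1}ef mem_phi// => utf; have := val f u fs uN; rewrite (negPf utf).
- move=> f j /tofP[ts ->]; set t := tof f in ts *.
  have /and3P[_ _ adj] := tok _ ts.
  have /orP[/hasP[g gs /andP[jg gall]]|/hasP[m m3 /andP[jm mall]]] :=
    forall3P j adj.
    left; exists (triangle phi g); first exact: map_f.
    split=> [|i ij]; first by rewrite tnth_triangle mem_phi// inNj.
    rewrite tnth_triangle mem_phi ?inNj//.
    by have /orP[/eqP/ord_inj/eqP|//] := forall3P i gall; rewrite (negPf ij).
  right; exists (inord m); rewrite mem_iota/= in m3.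
    by rewrite pt// mxE inordK// -Zr0 Zr_lt.
  move=> i ij; rewrite pt// mxE inordK//.
  have /orP[/eqP/ord_inj/eqP|/eqP] := forall3P i mall;
    first by rewrite (negPf ij).
  by rewrite /Zcoord => ->.
- move=> j; rewrite tnth_triangle pphi; last exact/oN/mem_corners.
  apply/rowP => i; rewrite !mxE eqxx/=.
  have /eqP : Zcoord (nth 0%N (corners o) j) i == if (j : nat) == i then 1 else
    0.
    exact: (forall3P i (forall3P j ounit)).
  by rewrite /Zcoord => ->; rewrite eq_sym -val_eqE; case: eqP.
- move=> f v fs /(vertex _ _ fs)[u -> [_ uN]]; rewrite mem_phio// => uo j.
  have := interior u (inI _ uN); rewrite (negPf uo)/= => /(forall3P j).
  by rewrite pphi// mxE -Zr_lt Zr0.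
Qed.

End Certificate.

(** * Radial projection of open cones *)

(* The [U i] cut [W] into disjoint relatively clopen connected pieces. *)
Lemma connected_component_open_cover (T : topologicalType) (I : Type)
    (D : set I) (U : I -> set T) (W : set T) (i : I) (x : T) :
    (forall j, D j -> open (U j)) -> W `<=` \bigcup_(j in D) U j ->
    (forall j, D j -> U i `&` U j !=set0 -> U j = U i) ->
    D i -> connected (W `&` U i) -> W x -> U i x ->
  connected_component W x = W `&` U i.
Proof.
move=> oU WU disj Di conn Wx Uix; apply/seteqP; split; last first.
  exact: connected_component_max.
have CW := @connected_component_sub _ W x.
suff <- : connected_component W x `&` U i = connected_component W x.
  by move=> y [/CW].
apply: component_connected.
- by exists x; split=> //; apply: connected_component_refl.
- by exists (U i); [apply: oU|].
- exists (~` \bigcup_(j in [set j | D j /\ U j <> U i]) U j).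
    by apply: open_closedC; apply: bigcup_open => j [/oU].
  apply/seteqP; split=> y [Cy].
    move=> Uiy; split=> // -[j [Dj nj] Ujy]; apply: nj; apply: disj => //.
    by exists y.
  move=> nUy; split=> //; have [j Dj Ujy] := WU _ (CW _ Cy).
  have [<-//|nj] := pselect (U j = U i).
  by exfalso; apply: nUy; exists j.
Qed.

Section Projection.
Variable R : realType.
Implicit Types (x y : 'rV[R]_3) (A U : set 'rV[R]_3).

Definition sqnorm x : R := \sum_(i < 3) x ord0 i ^+ 2.

Definition radial x : 'rV[R]_3 := (Num.sqrt (sqnorm x))^-1 *: x.

Lemma sqnorm_gt0 x : x != 0 -> 0 < sqnorm x.
Proof.
move=> /eqP x0; rewrite lt_neqAle eq_sym sumr_ge0 ?andbT => [|i _]; last first.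
  exact: sqr_ge0.
rewrite psumr_eq0 => [|i _]; last exact: sqr_ge0.
apply/negP => /allP x00; apply: x0; apply/rowP => i.
by have := x00 i (mem_index_enum _); rewrite mxE /= sqrf_eq0 => /eqP.
Qed.

Lemma sqnormZ a x : sqnorm (a *: x) = a ^+ 2 * sqnorm x.
Proof. by rewrite /sqnorm mulr_sumr; apply: eq_bigr => i _;
  rewrite mxE exprMn. Qed.

Lemma sphere_neq0 x : sphere R x -> x != 0.
Proof.
move=> Sx; apply/eqP => x0; move: Sx; rewrite /sphere /= x0 => /eqP.
by rewrite big1 ?(eq_sym 0) ?oner_eq0// => i _; rewrite mxE expr0n.
Qed.

Lemma radial_scale x : x != 0 -> exists2 a, 0 < a & radial x = a *: x.
Proof.
by move=> /sqnorm_gt0 x0; exists (Num.sqrt (sqnorm x))^-1;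
  rewrite // invr_gt0 sqrtr_gt0.
Qed.

Lemma radial_sphere x : x != 0 -> sphere R (radial x).
Proof.
move=> /sqnorm_gt0 x0; rewrite /sphere /= -/(sqnorm _) sqnormZ exprVn.
by rewrite sqr_sqrtr ?ltW// mulVf// gt_eqF.
Qed.

Lemma radial_id x : sphere R x -> radial x = x.
Proof. by rewrite /sphere/= /radial /sqnorm => ->;
  rewrite sqrtr1 invr1 scale1r. Qed.

Lemma radialZ a x : 0 < a -> radial (a *: x) = radial x.
Proof.
move=> a0; rewrite /radial sqnormZ sqrtrM ?sqr_ge0// sqrtr_sqr gtr0_norm//.
by rewrite invfM scalerA mulrAC mulVf ?mul1r// gt_eqF.
Qed.

Lemma radial_eq x y : x != 0 -> y != 0 -> radial x = radial y ->
  exists2 a, 0 < a & x = a *: y.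
Proof.
move=> /radial_scale[a a0 ->] /radial_scale[b b0 ->] eqxy.
exists (a^-1 * b); first by rewrite mulr_gt0 ?invr_gt0.
by rewrite -scalerA -eqxy scalerA mulVf ?scale1r// gt_eqF.
Qed.

Lemma linear_continuous_row (a : 'I_3 -> R) :
  continuous (fun x : 'rV[R]_3 => \sum_i x 0 i * a i : R).
Proof.
apply: continuous_big => [|i _ x]; first exact: add_continuous.
by apply: continuousM; [exact: coord_continuous|exact: cst_continuous].
Qed.

Lemma sqnorm_continuous : continuous (sqnorm : 'rV[R]_3 -> R).
Proof.
apply: continuous_big => [|i _ x]; first exact: add_continuous.
by apply: continuousM; exact: coord_continuous.
Qed.

Lemma radial_continuous x : x != 0 -> {for x, continuous radial}.
Proof.
move=> /sqnorm_gt0 x0; apply: continuousZ; last exact: cvg_id.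
apply: continuousV; first by rewrite gt_eqF ?sqrtr_gt0.
apply: continuous_comp; first exact: sqnorm_continuous.
exact: sqrt_continuous.
Qed.

Lemma segment_continuous x y :
  continuous (fun t : R => (1 - t) *: x + t *: y : 'rV[R]_3).
Proof.
move=> t; apply: cvgD; apply: cvgZr_tmp; last exact: cvg_id.
by apply: cvgB; [exact: cvg_cst|exact: cvg_id].
Qed.

Definition convex_set A := forall x y t, A x -> A y -> 0 <= t <= 1 ->
  A ((1 - t) *: x + t *: y).

(** A nonempty convex set is the union of the segments from one of its points, each a continuous
    image of an interval. *)
Lemma convex_connected A : convex_set A -> connected A.
Proof.
move=> cA; have [[x Ax]|A0] := pselect (A !=set0); last first.
  by rewrite (_ : A = set0); [exact: connected0|exact/nonemptyPn].
pose seg y := (fun t : R => (1 - t) *: x + t *: y) @` `[0, 1].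
have -> : A = \bigcup_(y in A) seg y.
  apply/seteqP; split=> [y Ay|_ [y Ay [t /= t01 <-]]].
    exists y => //; exists 1; first by rewrite /= in_itv/= ler01 lexx.
    by rewrite subrr scale0r add0r scale1r.
  by apply: cA => //; move: t01; rewrite in_itv.
apply: bigcup_connected.
  exists x => y Ay; exists 0; first by rewrite /= in_itv/= ler01 lexx.
  by rewrite subr0 scale0r addr0 scale1r.
move=> y Ay; apply: connected_continuous_connected;
  first exact: segment_connected.
by apply: continuous_subspaceT; exact: segment_continuous.
Qed.

(** [radial] fixes the sphere and moves a nonzero vector along its own ray, so it retracts a cone
    avoiding 0 onto its trace. *)
Lemma cone_section U : ~ U 0 -> (forall a x, 0 < a -> U x -> U (a *: x)) ->
  sphere R `&` U = radial @` U.
Proof.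
move=> U0 UZ; apply/seteqP; split=> [x [Sx Ux]|_ [x Ux <-]].
  by exists x => //; exact: radial_id.
have x0 : x != 0 by apply/eqP => x0; apply: U0; rewrite -x0.
split; first exact: radial_sphere.
by have [a a0 ->] := radial_scale x0; apply: UZ.
Qed.

Lemma cone_section_connected U : ~ U 0 ->
    (forall a x, 0 < a -> U x -> U (a *: x)) -> connected U ->
  connected (sphere R `&` U).
Proof.
move=> U0 UZ cU; rewrite cone_section//;
  apply: connected_continuous_connected => //.
apply: continuous_in_subspaceT => x /set_mem Ux; apply: radial_continuous.
by apply/eqP => x0; apply: U0; rewrite -x0.
Qed.

(** The projections of the points [x + t *: y] lie in the cone and tend to [x] as [t] decreases to
    0. *)
Lemma cone_section_closure U x y : ~ U 0 ->
    (forall a x, 0 < a -> U x -> U (a *: x)) -> sphere R x ->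
    (forall t, 0 < t -> U (x + t *: y)) ->
  closure (sphere R `&` U) x.
Proof.
move=> U0 UZ Sx Uxy; rewrite cone_section// => B.
have g0 : radial (x + 0 *: y) = x by rewrite scale0r addr0 radial_id.
have gc : {for 0, continuous (fun t : R => radial (x + t *: y))}.
  apply: (@continuous_comp _ _ _ (fun t : R => x + t *: y) radial).
    apply: cvgD; first exact: cvg_cst.
    by apply: cvgZr_tmp; exact: cvg_id.
  by apply: radial_continuous; rewrite scale0r addr0 sphere_neq0.
rewrite -{1}g0 => /gc /nbhs_ballP[e /= e0 eB].
exists (radial (x + (e / 2) *: y)); split.
  by exists (x + (e / 2) *: y) => //; apply: Uxy; rewrite divr_gt0.
apply: eB; rewrite /ball/= sub0r normrN gtr0_norm ?divr_gt0//.
by rewrite ltr_pdivrMr// mulr_natr mulr2n ltrDl.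
Qed.

(** The direction [y] pushes [C] into [U], so the trace of [C] is the closure of the trace of [U].
    For a triangle, [y] will be the sum of its corners; for the outer cone, the vector with all
    entries -1. *)
Lemma cone_section_boundary U (C : set 'rV[R]_3) (y : 'rV[R]_3) :
    ~ U 0 -> (forall a x, 0 < a -> U x -> U (a *: x)) ->
    open U -> closed C -> U `<=` C ->
    (forall x t, C x -> 0 < t -> U (x + t *: y)) ->
  sphere_boundary (sphere R `&` U) = sphere R `&` (C `\` U).
Proof.
move=> U0 UZ oU cC UC CU; apply/seteqP; split=> x.
  move=> [[Sx clx] clSx]; split=> //; split.
    have : closure C x by apply: closureS clx => z [_ /UC].
    by rewrite -(closure_id C).1.
  have : closure (~` U) x by apply: closureS clSx => z [Sz SUz] Uz; apply: SUz.
  by rewrite -(closure_id _).1 //; apply: open_closedC.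
move=> [Sx [Cx nUx]]; split; first split=> //.
  by apply: cone_section_closure U0 UZ Sx _ => t t0; apply: CU.
by apply: subset_closure; split=> // -[_ /nUx].
Qed.
End Projection.

(** * Fans triangulate the sphere *)

Section FanCones.
Variables (R : realType) (V : finType) (p : V -> 'rV[R]_3).
Variables (K : 3.-tuple V -> Prop) (o : 3.-tuple V).
Hypothesis FK : fan o K p.
Implicit Types (f g : 3.-tuple V) (x y : V).

(** Presents a point over a side as a combination of the whole triangle, so that [fan_sep] applies
    to edges. The case [x = y] is allowed, and the two coefficients then add up. *)
Lemma comb_pair f x y (al be : R) : uniq f -> x \in f -> y \in f ->
  0 <= al -> 0 <= be ->
  exists c : 'rV[R]_3, [/\ nneg c, comb p f c = al *: p x + be *: p y &
    forall v, weight f c v = al * (x == v)%:R + be * (y == v)%:R].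
Proof.
move=> uf xf yf al0 be0; have injf := inj_eq (tuple_uniqP _ uf).
pose c : 'rV[R]_3 := \row_l (al * (x == tnth f l)%:R + be * (y == tnth f l)%:R).
have wc v : weight f c v = al * (x == v)%:R + be * (y == v)%:R.
  have [/tnthP[l ->]|vf] := boolP (v \in f).
    by rewrite weight_tnth// mxE.
  rewrite weight_out//; have ne z : z \in f -> (z == v) = false.
    by move=> zf; apply: contraNF vf => /eqP <-.
  by rewrite !ne// !mulr0 addr0.
exists c; split=> //; first by move=> l;
  rewrite mxE addr_ge0// mulr_ge0// ler0n.
rewrite comb_weight (eq_bigr (fun v =>
  al * (x == v)%:R *: p v + be * (y == v)%:R *: p v)).
  rewrite big_split/=; congr (_ + _).
    rewrite (bigD1 x)//= eqxx mulr1 big1 ?addr0// => v.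
    by rewrite eq_sym => /negPf->; rewrite mulr0 scale0r.
  rewrite (bigD1 y)//= eqxx mulr1 big1 ?addr0// => v.
  by rewrite eq_sym => /negPf->; rewrite mulr0 scale0r.
by move=> v _; rewrite wc scalerDl.
Qed.

Lemma pair_sep f g x y x' y' (al be al' be' : R) : K f -> K g ->
    x \in f -> y \in f -> x' \in g -> y' \in g ->
    0 <= al -> 0 <= be -> 0 <= al' -> 0 <= be' ->
    al *: p x + be *: p y = al' *: p x' + be' *: p y' ->
  forall v, al * (x == v)%:R + be * (y == v)%:R =
            al' * (x' == v)%:R + be' * (y' == v)%:R.
Proof.
move=> Kf Kg xf yf xg yg al0 be0 al0' be0'.
have [c [c0 <- wc]] := comb_pair (fan_uniq FK Kf) xf yf al0 be0.
have [d [d0 <- wd]] := comb_pair (fan_uniq FK Kg) xg yg al0' be0'.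
by move=> /(fan_sep FK Kf Kg c0 d0) wcd v; rewrite -wc -wd.
Qed.

(** The positive and negative parts of a kernel vector are nonnegative combinations with the same
    value; by [fan_sep] they agree, so the vector is 0. *)
Lemma fan_unit f : K f -> \matrix_j p (tnth f j) \in unitmx.
Proof.
move=> Kf; rewrite -row_free_unit; apply: inj_row_free => v vA0.
pose pos : 'rV[R]_3 := \row_j Num.max (v 0 j) 0.
pose neg : 'rV[R]_3 := \row_j Num.max (- v 0 j) 0.
have vE : v = pos - neg.
  by apply/rowP => j; rewrite !mxE; case: (leP (v 0 j)); case: (leP (- v 0 j));
    lra.
have pos0 : nneg pos by move=> j; rewrite mxE le_max lexx orbT.
have neg0 : nneg neg by move=> j; rewrite mxE le_max lexx orbT.
have : comb p f pos = comb p f neg.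
  by apply/eqP; rewrite -subr_eq0 !comb_rows -mulmxBl -vE vA0.
move=> /(fan_sep FK Kf Kf pos0 neg0) w; rewrite vE.
apply/rowP => j; have wj := w (tnth f j).
rewrite !weight_tnth ?(fan_uniq FK)// in wj.
by rewrite mxE [X in _ + X]mxE wj subrr mxE.
Qed.

Definition open_tri f : set 'rV[R]_3 :=
  [set z | exists2 c : 'rV[R]_3, (forall j, 0 < c 0 j) & z = comb p f c].

Definition closed_tri f : set 'rV[R]_3 :=
  [set z | exists2 c, nneg c & z = comb p f c].

Definition boundary_tri f : set 'rV[R]_3 :=
  [set z | exists c, [/\ nneg c, exists j, c 0 j = 0 & z = comb p f c]].

Definition outer : set 'rV[R]_3 := [set z | exists j, z 0 j < 0].

Definition tri_coord f (j : 'I_3) (z : 'rV[R]_3) : R :=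
  (z *m invmx (\matrix_j p (tnth f j))) 0 j.

Lemma tri_coord_continuous f j : continuous (tri_coord f j).
Proof.
have -> : tri_coord f j =
    (fun z : 'rV[R]_3 => \sum_i z 0 i * (invmx (\matrix_j p (tnth f j))) i j).
  by apply/funext => z; rewrite /tri_coord mxE.
exact: linear_continuous_row.
Qed.

Lemma tri_coordP f z : K f -> z = comb p f (\row_j tri_coord f j z).
Proof.
move=> Kf; rewrite comb_rows (_ : \row_j _ = z *m invmx (\matrix_j p (tnth f
  j))).
  by rewrite mulmxKV// fan_unit.
by apply/rowP => j; rewrite mxE.
Qed.

Lemma tri_coord_comb f c j : K f -> tri_coord f j (comb p f c) = c 0 j.
Proof. by move=> Kf; rewrite /tri_coord comb_rows mulmxK// fan_unit. Qed.

Lemma open_triP f z : K f -> open_tri f z <-> forall j, 0 < tri_coord f j z.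
Proof.
move=> Kf; split=> [[c c0 ->] j|z0]; first by rewrite tri_coord_comb.
by exists (\row_j tri_coord f j z); [move=> j; rewrite mxE|exact: tri_coordP].
Qed.

Lemma closed_triP f z : K f -> closed_tri f z <-> forall j,
  0 <= tri_coord f j z.
Proof.
move=> Kf; split=> [[c c0 ->] j|z0]; first by rewrite tri_coord_comb.
by exists (\row_j tri_coord f j z); [move=> j; rewrite mxE|exact: tri_coordP].
Qed.

Lemma open_tri_open f : K f -> open (open_tri f).
Proof.
move=> Kf; have -> : open_tri f =
    ~` \bigcup_(j in [set: 'I_3]) (tri_coord f j @^-1` [set a | a <= 0]).
  apply/seteqP; split=> z.
    by move=> /(open_triP _ Kf) z0 [j _] /=; rewrite leNgt z0.
  move=> z0; apply/(open_triP _ Kf) => j; rewrite ltNge; apply/negP => zj.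
  by apply: z0; exists j.
apply: closed_openC; apply: closed_bigcup; first exact: finite_finset.
move=> j _; apply: closed_comp; last exact: closed_le.
by move=> z _; exact: tri_coord_continuous.
Qed.

Lemma closed_tri_closed f : K f -> closed (closed_tri f).
Proof.
move=> Kf; have -> : closed_tri f =
    \bigcap_(j in [set: 'I_3]) (tri_coord f j @^-1` [set a | 0 <= a]).
  apply/seteqP; split=> z; first by move=> /(closed_triP _ Kf) zf j _;
    exact: zf.
  by move=> zf; apply/(closed_triP _ Kf) => j; exact: zf.
apply: closed_bigI => j _; apply: closed_comp; last exact: closed_ge.
by move=> z _; exact: tri_coord_continuous.
Qed.

Lemma open_tri0 f : K f -> ~ open_tri f 0.
Proof.
move=> Kf [c c0 /esym c00]; have := c0 0; rewrite -(tri_coord_comb _ _ Kf) c00.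
by rewrite /tri_coord mul0mx mxE ltxx.
Qed.

Lemma combZ f a c : comb p f (a *: c) = a *: comb p f c.
Proof. by rewrite !comb_rows scalemxAl. Qed.

Lemma combD f c d : comb p f (c + d) = comb p f c + comb p f d.
Proof. by rewrite !comb_rows mulmxDl. Qed.

Lemma open_triZ f a z : 0 < a -> open_tri f z -> open_tri f (a *: z).
Proof.
move=> a0 [c c0 ->]; exists (a *: c); last by rewrite combZ.
by move=> j; rewrite mxE mulr_gt0.
Qed.

Lemma open_tri_connected f : connected (open_tri f).
Proof.
apply: convex_connected => _ _ t [c c0 ->] [d d0 ->] t01.
exists ((1 - t) *: c + t *: d); last by rewrite combD !combZ.
move=> j; rewrite !mxE; have := c0 j; have := d0 j; have /andP[t0 t1] := t01.
by move=> dj cj; have := mulr_ge0 t0 (ltW dj); nra.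
Qed.

Lemma open_tri_boundary f : K f ->
  sphere_boundary (sphere R `&` open_tri f) = sphere R `&` boundary_tri f.
Proof.
move=> Kf; rewrite (@cone_section_boundary _ _ (closed_tri f) (comb p f
  (const_mx 1))).
- congr (_ `&` _); apply/seteqP; split=> z.
    move=> [[c c0 zc] nz]; exists c; split=> //; apply/not_existsP => nc.
    apply: nz; exists c => // j; rewrite lt_neqAle c0 andbT eq_sym.
    by apply/eqP/nc.
  move=> [c [c0 [j cj] ->]]; split; first by exists c.
  by move=> [d d0] /(congr1 (tri_coord f j));
    rewrite !tri_coord_comb// cj => dj; have := d0 j; rewrite -dj ltxx.
- exact: open_tri0.
- by move=> *; apply: open_triZ.
- exact: open_tri_open.
- exact: closed_tri_closed.
- by move=> z [c c0 ->]; exists c => // j; rewrite ltW.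
- move=> z t [c c0 ->] t0; exists (c + t *: const_mx 1);
    last by rewrite combD combZ.
  by move=> j; rewrite !mxE mulr1 ltr_wpDl.
Qed.

(** The weights of a common point are positive at all corners of [f] and zero off [g]. Triangles are
    ordered tuples, so the outcome is an inclusion of cones and not [f = g]. *)
Lemma open_tri_meet f g : K f -> K g -> open_tri f `&` open_tri g !=set0 ->
  {subset f <= g} /\ open_tri f `<=` open_tri g.
Proof.
have sub f' g' z : K f' -> K g' -> open_tri f' z -> open_tri g' z ->
    {subset f' <= g'}.
  move=> Kf Kg [c c0 ->] [d d0 cd] v /tnthP[j ->].
  have := fan_sep FK Kf Kg (fun j => ltW (c0 j)) (fun j =>
    ltW (d0 j)) cd (tnth f' j).
  rewrite weight_tnth ?(fan_uniq FK)// => cj; apply: contraTT (c0 j) => vg.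
  by rewrite cj weight_out// ltxx.
move=> Kf Kg [z [zf zg]]; have fg := sub _ _ _ Kf Kg zf zg.
have gf := sub _ _ _ Kg Kf zg zf; split=> // _ [c c0 ->].
have uf := fan_uniq FK Kf; have ug := fan_uniq FK Kg.
exists (\row_l weight f c (tnth g l)).
  move=> l; rewrite mxE; have /tnthP[j ->] := gf _ (mem_tnth l g).
  by rewrite weight_tnth.
rewrite !comb_weight; apply: eq_bigr => v _; congr (_ *: _).
have [/tnthP[l ->]|vg] := boolP (v \in g); first by rewrite weight_tnth// mxE.
by rewrite !weight_out//; apply: contra vg; apply: fg.
Qed.

Lemma outer_open : open outer.
Proof.
have -> : outer = \bigcup_(j in [set: 'I_3]) ((fun z : 'rV[R]_3 =>
  z 0 j) @^-1` [set a | a < 0]).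
  by apply/seteqP; split=> z; [move=> [j zj]; exists j|move=> [j _ zj];
    exists j].
apply: bigcup_open => j _; apply: open_comp; last exact: open_lt.
by move=> z _; exact: coord_continuous.
Qed.

Lemma outer0 : ~ outer 0.
Proof. by move=> [j]; rewrite mxE ltxx. Qed.

Lemma outerZ a z : 0 < a -> outer z -> outer (a *: z).
Proof. by move=> a0 [j zj]; exists j; rewrite mxE pmulr_rlt0. Qed.

(** Three open half-spaces share the vector with all entries -1. *)
Lemma outer_connected : connected outer.
Proof.
have -> : outer = \bigcup_(j in [set: 'I_3]) [set z | z 0 j < 0].
  by apply/seteqP; split=> z; [move=> [j zj]; exists j|move=> [j _ zj];
    exists j].
apply: bigcup_connected.
  by exists (const_mx (-1)) => j _ /=; rewrite mxE oppr_lt0 ltr01.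
move=> j _; apply: convex_connected => y z t /= yj zj /andP[t0 t1].
by rewrite !mxE; nra.
Qed.

Lemma comb_corner c : uniq o -> comb p o c = c.
Proof.
move=> uo; apply/rowP => j; rewrite summxE (bigD1 j)//= big1 => [|i ij].
  by rewrite mxE (fan_corner FK) mxE !eqxx mulr1 addr0.
by rewrite mxE (fan_corner FK) mxE [j == i]eq_sym (negPf ij) andbF mulr0.
Qed.

(** The corners of [o] are the standard basis, so a combination over [o] is its own coefficient
    vector and the boundary of the octant is the cone over the sides of [o]. *)
Lemma outer_boundary : uniq o ->
  sphere_boundary (sphere R `&` outer) = sphere R `&` boundary_tri o.
Proof.
move=> uo; rewrite (@cone_section_boundary _ _
  (\bigcup_(j in [set: 'I_3]) ((fun z : 'rV[R]_3 =>
    z 0 j) @^-1` [set a | a <= 0]))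
  (const_mx (-1))).
- congr (_ `&` _); apply/seteqP; split=> z.
    move=> [[j _ /= zj] nz]; have z0 : nneg z.
      by move=> i; rewrite leNgt; apply/negP => zi; apply: nz; exists i.
    exists z; split=> //; last by rewrite comb_corner.
    by exists j; apply/eqP; rewrite eq_le zj z0.
  move=> [c [c0 [j cj] ->]]; rewrite comb_corner//; split.
    by exists j => //=; rewrite cj.
  by move=> [i]; rewrite ltNge c0.
- exact: outer0.
- exact: outerZ.
- exact: outer_open.
- apply: closed_bigcup; first exact: finite_finset.
  move=> j _; apply: closed_comp; last exact: closed_le.
  by move=> z _; exact: coord_continuous.
- by move=> z [j zj]; exists j => //=; rewrite ltW.
- move=> z t [j _ /= zj] t0; exists j; rewrite !mxE mulrN1.
  by rewrite (le_lt_trans _ (_ : - t < 0)) ?oppr_lt0// gerDr.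
Qed.

End FanCones.

(** * The geodesic drawing of a graph carried by a fan *)

Section Triangulation.
Variables (R : realType) (G : graph) (p : vertex G -> 'rV[R]_3).
Variables (K : 3.-tuple (vertex G) -> Prop) (o : 3.-tuple (vertex G)).
Hypothesis FK : fan o K p.
Hypothesis uo : uniq o.
Hypothesis simple_G : simple_graph G.
Hypothesis edge_in_face : forall e : edge G,
  exists2 f, K f & (ends e).1 \in f /\ (ends e).2 \in f.
Hypothesis face_side : forall f x y, K f \/ f = o -> x \in f -> y \in f ->
  x != y -> exists e : edge G, joins e x y.
Hypothesis vertex_in_face : forall v, exists2 f, K f & v \in f.

Implicit Types e : edge G.

Definition point v : 'rV[R]_3 := radial (p v).

Definition chord (e : edge G) (s : R) : 'rV[R]_3 :=
  (1 - s) *: p (ends e).1 + s *: p (ends e).2.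

Definition geodesic e s := radial (chord e s).

(** A vanishing combination would have all its weights equal to 0 by [pair_sep], against
    [0 < al + be]. *)
Lemma pair_neq0 f x y (al be : R) : K f -> x \in f -> y \in f ->
  0 <= al -> 0 <= be -> 0 < al + be -> al *: p x + be *: p y != 0.
Proof.
move=> Kf xf yf al0 be0 ab; apply/eqP => ab0.
have := pair_sep FK Kf Kf xf yf xf xf al0 be0 (lexx 0) (lexx 0).
rewrite ab0 !scale0r addr0 => /(_ erefl) w; have := w x; have := w y.
rewrite !mul0r addr0 !eqxx !mulr1.
have := mulr_ge0 al0 (ler0n R (x == y));
  have := mulr_ge0 be0 (ler0n R (y == x)).
lra.
Qed.

Lemma p_neq0 v : p v != 0.
Proof.
have [f Kf vf] := vertex_in_face v.
have := @pair_neq0 f v v 1 0 Kf vf vf ler01 (lexx 0).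
by rewrite addr0 scale1r scale0r addr0; apply.
Qed.

Lemma chord_neq0 e s : 0 <= s <= 1 -> chord e s != 0.
Proof.
move=> /andP[s0 s1]; have [f Kf [xf yf]] := edge_in_face e.
by apply: pair_neq0 Kf xf yf _ _ _; lra.
Qed.

Lemma ends_neq e : (ends e).1 != (ends e).2.
Proof. by apply/eqP; exact: simple_G.1. Qed.

Lemma point_inj : injective point.
Proof.
move=> v w /(radial_eq (p_neq0 v) (p_neq0 w))[a a0 pv].
have [f Kf vf] := vertex_in_face v; have [g Kg wg] := vertex_in_face w.
have := pair_sep FK Kf Kg vf vf wg wg ler01 (lexx 0) (ltW a0) (lexx 0).
rewrite scale1r !scale0r !addr0 => /(_ pv v).
rewrite !mul0r !addr0 mul1r eqxx eq_sym; case: eqVneq => // _.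
by rewrite mulr0 => /eqP; rewrite oner_eq0.
Qed.

(** An inner point of the arc has positive weight at both ends of [e], while a multiple of [p v] has
    weight only at [v]. *)
Lemma geodesic_avoids_point e v s : 0 < s < 1 -> geodesic e s <> point v.
Proof.
move=> /andP[s0 s1] eqv.
have s01 : 0 <= s <= 1 by lra.
have [a a0] := radial_eq (chord_neq0 e s01) (p_neq0 v) eqv.
have [f Kf [xf yf]] := edge_in_face e; have [g Kg vg] := vertex_in_face v.
have s1' : 0 <= 1 - s by lra.
have := pair_sep FK Kf Kg xf yf vg vg s1' (ltW s0) (ltW a0) (lexx 0).
rewrite /chord scale0r addr0 => w /w {}w.
have := w (ends e).1; have := w (ends e).2; have := ends_neq e.
rewrite eqxx [(ends e).2 == _]eq_sym => /[dup] xy /negPf->;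
  rewrite eqxx !mul0r !mulr1 !mulr0 !addr0 add0r.
by case: eqVneq => [->|_]; rewrite ?[_ == (ends e).1]eq_sym ?(negPf xy) ?mulr0;
  lra.
Qed.

(** A common point has positive weight exactly at the ends of [e] and exactly at those of [f], so
    the edges coincide by simplicity. The weights at the two ends then force the scaling factor [a]
    to be 1, and [s = t]. *)
Lemma geodesic_disjoint e f s t : 0 < s < 1 -> 0 < t < 1 ->
  geodesic e s = geodesic f t -> e = f /\ s = t.
Proof.
move=> /andP[s0 s1] /andP[t0 t1] eqef.
have s01 : 0 <= s <= 1 by lra.
have t01 : 0 <= t <= 1 by lra.
have [a a0] := radial_eq (chord_neq0 e s01) (chord_neq0 f t01) eqef.
have [g Kg [xg yg]] := edge_in_face e; have [h Kh [xh yh]] := edge_in_face f.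
have s1' : 0 <= 1 - s by lra.
have at1 : 0 <= a * (1 - t) by apply: mulr_ge0; lra.
have at0 : 0 <= a * t by apply: mulr_ge0; lra.
have at1' : 0 < a * (1 - t) by apply: mulr_gt0; lra.
have at0' : 0 < a * t by apply: mulr_gt0; lra.
have := pair_sep FK Kg Kh xg yg xh yh s1' (ltW s0) at1 at0.
rewrite /chord [_ *: (_ + _)]scalerDr !scalerA => w /w {}w.
have wx := w (ends e).1; have wy := w (ends e).2.
have wx' := w (ends f).1; have wy' := w (ends f).2.
have nxy := ends_neq e; have nxy' := ends_neq f.
suff ef : e = f.
  split=> //; move: wx wy; rewrite ef !eqxx (negPf nxy') eq_sym (negPf nxy').
  rewrite !mulr0 !mulr1 !addr0 !add0r => e1 e2.
  have a1 : a = 1 by lra.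
  by move: e2; rewrite a1 mul1r.
apply: (simple_G.2 _ _ (ends e).1 (ends e).2); first by left; case: (ends e).
move: wx wy; rewrite !eqxx (negPf nxy) eq_sym (negPf nxy).
rewrite /joins; case: (ends e) nxy => x y /= nxy;
  case: (ends f) nxy' => x' y' /= nxy'.
rewrite !mulr0 !mulr1 addr0 add0r.
case: (eqVneq x' x) => [->|nx].
  rewrite (negPf nxy) mulr0 add0r => _; case: (eqVneq y' y) => [->|_];
    first by left.
  by rewrite mulr0 => ?; exfalso; lra.
rewrite mulr0 add0r; case: (eqVneq y' x) => [->|_]; last by rewrite mulr0 => ?;
  exfalso; lra.
rewrite (negPf nxy) => _; case: (eqVneq x' y) => [->|_]; first by right.
by rewrite !mulr0 addr0 => ?; exfalso; lra.
Qed.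

(** This form of the arc does not depend on the orientation of the edge. *)
Lemma geodesic_image e x y : joins e x y -> geodesic e @` `[0, 1] =
  sphere R `&` [set z | exists al be, [/\ 0 <= al,
    0 <= be & z = al *: p x + be *: p y]].
Proof.
move=> exy.
have -> : [set z | exists al be, [/\ 0 <= al,
  0 <= be & z = al *: p x + be *: p y]] =
  [set z | exists al be, [/\ 0 <= al, 0 <= be &
     z = al *: p (ends e).1 + be *: p (ends e).2]].
  case: exy => -> //=; apply/seteqP; split=> z [al [be [al0 be0 ->]]];
  by exists be, al; split=> //; rewrite addrC.
have [f Kf [xf yf]] := edge_in_face e.
apply/seteqP; split=> [_ [s /= s01 <-]|z [Sz [al [be [al0 be0 zE]]]]].
  rewrite in_itv/= in s01; split; first exact/radial_sphere/chord_neq0.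
  rewrite /geodesic; have [a a0 ->] := radial_scale (chord_neq0 e s01).
  exists (a * (1 - s)), (a * s); rewrite scalerDr !scalerA.
  by have /andP[? ?] := s01; split=> //; apply: mulr_ge0; lra.
have ab : 0 < al + be.
  rewrite lt_neqAle addr_ge0// andbT eq_sym paddr_eq0//;
    apply/negP => /andP[/eqP a0 /eqP b0].
  by have := sphere_neq0 Sz; rewrite zE a0 b0 !scale0r addr0 eqxx.
(* Rescaling [al] and [be] to sum 1 does not change the projection. *)
exists (be / (al + be)).
  by rewrite /= in_itv/= divr_ge0 ?(ltW ab)// ler_pdivrMr// mul1r lerDr.
rewrite /geodesic -(radialZ _ ab) /chord scalerDr !scalerA.
by rewrite mulrBr mulr1 mulrCA divff ?gt_eqF// mulr1 addrK -zE radial_id.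
Qed.

(** A vanishing coefficient leaves the cone over the opposite side; its three possible positions
    give the three arcs. *)
Lemma boundary_tri_sides f x y z e1 e2 e3 : f = [tuple x; y; z] ->
    joins e1 x y -> joins e2 y z -> joins e3 z x ->
  sphere R `&` boundary_tri p f = geodesic e1 @` `[0, 1] `|`
    geodesic e2 @` `[0, 1] `|` geodesic e3 @` `[0, 1].
Proof.
move=> -> j1 j2 j3; rewrite (geodesic_image j1) (geodesic_image j2)
  (geodesic_image j3).
rewrite -!setIUr; congr (_ `&` _).
have combE c : comb p [tuple x; y;
  z] c = c 0 0 *: p x + c 0 1 *: p y + c 0 2%:R *: p z.
  rewrite /comb !big_ord_recr big_ord0 /= add0r.
  by congr (_ *: _ + _ *: _ + _ *: _); congr (c _ _); exact/val_inj.
apply/seteqP; split=> [w [c [c0 [j cj] ->]]|w].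
  rewrite combE; case: j cj => [[|[|[|]]]]// ? cj.
  - left; right; exists (c 0 1), (c 0 2%:R); split=> //.
    by rewrite (_ : c 0 0 = 0) ?scale0r ?add0r// -cj; congr (c _ _);
      exact/val_inj.
  - right; exists (c 0 2%:R), (c 0 0); split=> //.
    rewrite (_ : c 0 1 = 0) ?scale0r ?addr0 1?addrC// -cj.
    by congr (c _ _); exact/val_inj.
  - left; left; exists (c 0 0), (c 0 1); split=> //.
    by rewrite (_ : c 0 2%:R = 0) ?scale0r ?addr0// -cj; congr (c _ _);
      exact/val_inj.
pose vec (a b c : R) : 'rV[R]_3 := \row_j nth 0 [:: a; b; c] j.
have vec0 a b c : 0 <= a -> 0 <= b -> 0 <= c -> nneg (vec a b c).
  by move=> ? ? ? [[|[|[|]]]]//= ?; rewrite mxE.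
move=> [[|]|] [al [be [al0 be0 ->]]].
- exists (vec al be 0); split; [exact: vec0|by exists 2%:R; rewrite mxE|].
  by rewrite combE !mxE/= scale0r addr0.
- exists (vec 0 al be); split; [exact: vec0|by exists 0; rewrite mxE|].
  by rewrite combE !mxE/= scale0r add0r.
- exists (vec be 0 al); split; [exact: vec0|by exists 1; rewrite mxE|].
  by rewrite combE !mxE/= scale0r addr0 addrC.
Qed.

Lemma boundary_tri_triangle f (F : set 'rV[R]_3) : K f \/ f = o ->
  sphere_boundary F = sphere R `&` boundary_tri p f ->
  bounded_by_triangle geodesic F.
Proof.
move=> Kf FE; have uf : uniq f by case: Kf => [/(fan_uniq FK)|->].
pose x := tnth f 0; pose y := tnth f 1; pose z := tnth f 2%:R.
have fE : f = [tuple x; y; z].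
  apply: eq_from_tnth => -[[|[|[|]]]]// ?; rewrite [RHS](tnth_nth x)/=;
  by congr (tnth f _); exact: val_inj.
have ne i j : i != j -> tnth f i != tnth f j by rewrite (inj_eq (tuple_uniqP _
  uf)).
have nxy : x != y by exact: ne.
have nyz : y != z by exact: ne.
have nzx : z != x by exact: ne.
have [e1 j1] := face_side Kf (mem_tnth _ _) (mem_tnth _ _) nxy.
have [e2 j2] := face_side Kf (mem_tnth _ _) (mem_tnth _ _) nyz.
have [e3 j3] := face_side Kf (mem_tnth _ _) (mem_tnth _ _) nzx.
exists x, y, z, e1, e2, e3; split=> //.
  by rewrite /= !inE !negb_or nxy nyz eq_sym nzx.
by rewrite FE (boundary_tri_sides fE j1 j2 j3).
Qed.

(** Treats vertices and arcs uniformly: a vertex is the degenerate pair [v], [v]. *)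
Lemma drawing_pair z : drawing point geodesic z -> exists f x y (al be : R),
  [/\ K f, x \in f /\ y \in f, 0 <= al, 0 <= be & z = al *: p x + be *: p y].
Proof.
case=> [[v _ <-]|[e _ [s /= s01 <-]]].
  have [f Kf vf] := vertex_in_face v.
  rewrite /point; have [a a0 ->] := radial_scale (p_neq0 v).
  exists f, v, v, a, 0; split=> //; first exact: ltW.
  by rewrite scale0r addr0.
rewrite in_itv/= in s01; have [f Kf xyf] := edge_in_face e.
rewrite /geodesic; have [a a0 ->] := radial_scale (chord_neq0 e s01).
exists f, (ends e).1, (ends e).2, (a * (1 - s)), (a * s).
rewrite scalerDr !scalerA.
by have /andP[? ?] := s01; split=> //; apply: mulr_ge0; lra.
Qed.

Lemma drawing_not_outer z : drawing point geodesic z -> ~ outer z.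
Proof.
move=> /drawing_pair[f [x [y [al [be [Kf [xf yf] al0 be0 ->]]]]]] [j].
by rewrite !mxE ltNge addr_ge0// mulr_ge0//; apply: (fan_nneg FK Kf).
Qed.

(** A drawn point has weight on at most two vertices, a point of an open triangle on three. *)
Lemma drawing_not_open f z : K f -> drawing point geodesic z -> ~ open_tri p f
  z.
Proof.
move=> Kf /drawing_pair[g [x [y [al [be [Kg [xg yg] al0 be0 ->]]]]]] [c c0].
have [d [d0 <- wd]] := comb_pair p (fan_uniq FK Kg) xg yg al0 be0.
move=> /(fan_sep FK Kg Kf d0 (fun j => ltW (c0 j))) w.
have uf := fan_uniq FK Kf.
have sub : {subset f <= [:: x; y]}.
  move=> v /tnthP[j ->]; have := w (tnth f j); rewrite weight_tnth// wd !inE.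
  rewrite ![_ == tnth f j]eq_sym.
  case: (tnth f j == x) => //=; case: (tnth f j == y) => //=.
  by rewrite !mulr0 addr0 => cj; have := c0 j; rewrite -cj ltxx.
by have := uniq_leq_size uf sub; rewrite size_tuple.
Qed.

(** A point of the octant lies in some closed triangle, and a zero coefficient would put it on a
    drawn side. *)
Lemma complement_cover z : sphere R z -> ~ drawing point geodesic z ->
  ~ outer z -> exists2 f, K f & open_tri p f z.
Proof.
move=> Sz nz no; have z0 : nneg z.
  by move=> j; rewrite leNgt; apply/negP => zj; apply: no; exists j.
have [f Kf [c c0 zE]] := fan_cover FK z0; exists f => //; exists c => // j.
rewrite lt_neqAle c0 andbT eq_sym; apply/negP => /eqP cj; apply: nz; right.
have : (sphere R `&` boundary_tri p f) z by split=> //; exists c; split=> //;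
  exists j.
have Kf' : K f \/ f = o by left.
have [x [y [z' [e1 [e2 [e3 [_ _ _ _]]]]]]] :=
  boundary_tri_triangle Kf' (open_tri_boundary FK Kf).
rewrite (open_tri_boundary FK Kf) => -> [[|]|] ?;
  by [exists e1|exists e2|exists e3].
Qed.

Theorem triangulation_of_fan : sphere_triangulation R G.
Proof.
exists point, geodesic; split.
  split.
  - exact: point_inj.
  - by move=> v; exact/radial_sphere/p_neq0.
  - move=> e; apply: continuous_in_subspaceT => s /set_mem/=;
      rewrite in_itv/= => s01.
    rewrite (_ : geodesic e = @radial R \o chord e)//.
    apply: continuous_comp; first exact: segment_continuous.
    exact/radial_continuous/chord_neq0.
  - by move=> e _ [s /= + <-]; rewrite in_itv/= => s01;
      exact/radial_sphere/chord_neq0.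
  - by move=> e; rewrite /geodesic /chord subr0 scale1r scale0r addr0.
  - by move=> e; rewrite /geodesic /chord subrr scale0r scale1r add0r.
  - exact: geodesic_avoids_point.
  - exact: geodesic_disjoint.
set W := sphere R `\` drawing point geodesic.
(* [None] indexes the outer face and [Some f] the triangle [f]. The drawing meets none of these
   cones, so removing it leaves their traces intact. *)
pose D := [set i | if i is Some f then K f else True].
pose U i := if i is Some f then open_tri p f else @outer R : set 'rV[R]_3.
have WU i : D i -> W `&` U i = sphere R `&` U i.
  move=> Di; apply/seteqP; split=> z; first by move=> [[Sz _] Uz].
  move=> [Sz Uz]; split=> //; split=> // dz; case: i Di Uz => [f Kf|_].
    exact: drawing_not_open.
  exact: drawing_not_outer.
have comp i z : D i -> W z -> U i z ->
    connected_component W z = sphere R `&` U i.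
  move=> Di Wz Uz; rewrite -WU//.
  apply: (@connected_component_open_cover _ _ D U) => //.
  - by case=> [f Kf|_]; [exact: open_tri_open FK _ Kf|exact: outer_open].
  - move=> w [Sw nw]; have [ow|now] := pselect (outer w); first by exists None.
    by have [f Kf fw] := complement_cover Sw nw now; exists (Some f).
  - have tri_outer f : K f -> ~ (open_tri p f `&` @outer R !=set0).
      move=> Kf [w [[c c0 ->] [j]]]; rewrite ltNge comb_nneg//.
      by move=> v vf; apply: fan_nneg FK Kf vf.
      by move=> l; exact: ltW.
    case: i Di {Uz} => [f Kf|_] [g Kg ne|_ ne] //=.
    + apply/seteqP; split; last exact: (open_tri_meet FK Kf Kg ne).2.
      by apply: (open_tri_meet FK Kg Kf _).2; rewrite setIC.
    + by have := tri_outer _ Kf ne.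
    + by rewrite setIC in ne; have := tri_outer _ Kg ne.
  - rewrite WU//; case: i Di {Uz} => [f Kf|_]; apply: cone_section_connected.
    + exact: (open_tri0 FK Kf).
    + by move=> a w; exact: open_triZ.
    + exact: open_tri_connected.
    + exact: outer0.
    + by move=> a w; exact: outerZ.
    + exact: outer_connected.
move=> F [z Wz ->]; have [oz|noz] := pselect (outer z).
  rewrite (comp None)//; apply: (@boundary_tri_triangle o); first by right.
  exact: (outer_boundary FK).
have [f Kf fz] := complement_cover Wz.1 Wz.2 noz.
rewrite (comp (Some f))//; apply: (@boundary_tri_triangle f); first by left.
exact: (open_tri_boundary FK).
Qed.

End Triangulation.

(** * The fan of M_k *)

Local Open Scope Z_scope.

(* Vertices 31, 32, 33 of the block are the entry triangle of the next copy.
   The points and heights are rounded from a Tutte embedding and from its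
   Maxwell-Cremona lifting. *)
Definition block_pts : seq (Z * Z * Z) :=
  [:: (934, 334, 233); (1247, 170, 83); (1, 0, 0); (107, 41, 1353);
     (571, 106, 823); (913, 68, 519); (749, 557, 194); (975, 324, 201);
     (990, 313, 197); (983, 321, 196); (997, 321, 182); (931, 392, 177);
     (800, 513, 186); (1167, 222, 111); (1018, 307, 175); (1007, 315, 178);
     (978, 350, 171); (947, 386, 167); (1032, 318, 150); (0, 1, 0);
     (168, 1201, 131); (52, 1339, 109); (14, 1422, 64); (7, 1206, 287);
     (0, 0, 1); (47, 578, 875); (135, 1186, 179); (47, 1304, 150);
     (39, 1182, 279); (21, 1043, 435); (44, 1184, 272); (895, 323, 282);
     (754, 372, 374); (883, 376, 241)].

Definition block_hts : seq Z :=
  [:: -1168; -621; 0; -474; -880; -641; -1500; -1115; -1086; -1103; -1085;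
     -1202; -1420; -780; -1048; -1068; -1120; -1176; -1026; 0; -1091; -406;
     -134; -153; 0; -446; -921; -392; -380; -276; -410; -1163; -1274; -1243].

Definition cap_pts : seq (Z * Z * Z) :=
  [:: (1, 0, 0); (588, 257, 654); (489, 305, 706); (196, 675, 630); (0, 1, 0);
     (471, 715, 314); (0, 0, 1); (633, 95, 772); (699, 187, 614);
     (624, 139, 737); (580, 112, 808); (466, 85, 949); (240, 27, 1233);
     (613, 184, 704); (624, 171, 705); (609, 159, 733); (563, 120, 817);
     (507, 112, 881); (573, 146, 781); (442, 326, 733); (271, 307, 922);
     (370, 369, 761); (388, 363, 749); (414, 351, 736); (368, 402, 730);
     (297, 471, 733); (338, 394, 768); (353, 385, 762); (374, 383, 743);
     (365, 394, 741); (335, 416, 749)].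

Definition cap_hts : seq Z :=
  [:: 0; -1448; -1500; -1252; 0; -1248; 0; -753; -1197; -972; -837; -681;
     -320; -1179; -1127; -1068; -874; -823; -999; -1469; -1152; -1396; -1419;
     -1448; -1414; -1355; -1368; -1384; -1414; -1408; -1380].

Local Close Scope Z_scope.

Local Open Scope nat_scope.

(** The 58 = 2 * 31 - 4 faces of a planar embedding of [T], both ports included. *)
Definition T_faces : seq (nat * nat * nat) :=
  [:: (0, 1, 5); (0, 1, 8); (0, 4, 5); (0, 4, 6); (0, 6, 12); (0, 7, 8);
     (0, 7, 12); (1, 2, 5); (1, 2, 6); (1, 6, 12); (1, 8, 13); (1, 12, 13);
     (2, 3, 5); (2, 3, 24); (2, 6, 20); (2, 19, 20); (2, 19, 24); (3, 4, 5);
     (3, 4, 6); (3, 6, 20); (3, 20, 25); (3, 24, 25); (7, 8, 9); (7, 9, 10);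
     (7, 10, 11); (7, 11, 12); (8, 9, 14); (8, 13, 14); (9, 10, 15);
     (9, 14, 15); (10, 11, 16); (10, 15, 16); (11, 12, 17); (11, 16, 17);
     (12, 13, 17); (13, 14, 18); (13, 17, 18); (14, 15, 18); (15, 16, 18);
     (16, 17, 18); (19, 20, 21); (19, 21, 22); (19, 22, 23); (19, 23, 24);
     (20, 21, 26); (20, 25, 26); (21, 22, 27); (21, 26, 27); (22, 23, 28);
     (22, 27, 28); (23, 24, 29); (23, 28, 29); (24, 25, 29); (25, 26, 30);
     (25, 29, 30); (26, 27, 30); (27, 28, 30); (28, 29, 30)].

Definition annulus_faces : seq (nat * nat * nat) :=
  [:: (0, 4, 31); (4, 31, 32); (4, 6, 32); (6, 32, 33); (0, 6, 33);
     (0, 31, 33)].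

(** The port (0, 4, 6) gives way to the annulus, whose inner triangle (31, 32, 33) is left to the
    next copy; (2, 19, 24) is the outer triangle of the block. *)
Definition block_faces :=
  [seq t <- T_faces | (t != (0, 4, 6)) && (t != (2, 19, 24))] ++ annulus_faces.

(** The last copy is entered through (0, 4, 6), and its triangle (2, 19, 24) remains a face. *)
Definition cap_faces := [seq t <- T_faces | t != (0, 4, 6)].

(** Listed in the order of [annulus], so that positions match the second index of the edges
    [inr]. *)
Definition annulus_pairs : seq (nat * nat) :=
  [:: (0, 31); (4, 31); (4, 32); (6, 32); (6, 33); (0, 33)].

Lemma cap_certificate : lifting_certificate cap_pts cap_hts cap_faces (0, 4, 6).
Proof. by vm_compute. Qed.

Lemma block_certificate : lifting_certificate block_pts block_hts
  ((31, 32, 33) :: block_faces) (2, 19, 24).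
Proof. by vm_compute. Qed.

Section Model.
Variables (R : realType) (m : nat).
Notation k := m.+2.
Notation V := ('I_k * 'I_31)%type.

Definition vtx (i v : nat) : V := (inord i, inord v).

(* The triangle of copy [i] through which the previous copies are glued; for
   [i = 0] it is the outer face. *)
Definition entry (i : nat) : nat * nat * nat :=
  if i.+1 == k then (0, 4, 6) else (2, 19, 24).

Definition block_vertex (i v : nat) : V :=
  if v < 31 then vtx i v else vtx i.+1 (nth 0 (corners (entry i.+1)) (v - 31)).

Definition level_faces (i : nat) : seq (3.-tuple V) :=
  if i.+1 == k then [seq triangle (vtx i) t | t <- cap_faces]
  else [seq triangle (block_vertex i) t | t <- block_faces].

Definition faces_from (i : nat) (f : 3.-tuple V) : Prop :=
  exists2 j, i <= j < k & f \in level_faces j.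

Lemma vtx_level i v : i < k -> (vtx i v).1 = i :> nat.
Proof. by move=> ik; rewrite /= inordK. Qed.

Lemma vtx_inj i i' v v' : i < k -> i' < k -> v < 31 -> v' < 31 ->
  vtx i v = vtx i' v' -> i = i' /\ v = v'.
Proof.
move=> ik ik' v31 v31' [] /(congr1 val) + /(congr1 val).
by rewrite /= !inordK.
Qed.

Lemma entryP i : [/\ uniq (corners (entry i)),
  all (gtn 31) (corners (entry i)) &
  forall a b, a \in corners (entry i) -> b \in corners (entry i) -> a != b ->
    ((a, b) \in T_edges) || ((b, a) \in T_edges)].
Proof.
pose joined a b := [|| a == b, (a, b) \in T_edges | (b, a) \in T_edges].
have ok : all2rel joined (corners (entry i)).
  by rewrite /entry; case: ifP => _; vm_compute.
have : uniq (corners (entry i)) && all (gtn 31) (corners (entry i)).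
  by rewrite /entry; case: ifP.
move=> /andP[? ?]; split=> [//|//|a b ca cb /negPf ab].
have := allrelP ok a b ca cb; rewrite /joined ab orFb; exact.
Qed.

Lemma block_vertex_inj i : i.+1 < k -> {in gtn 34 &,
  injective (block_vertex i)}.
Proof.
move=> ik a b; rewrite !inE /block_vertex => a34 b34.
have [ue /allP e31 _] := entryP i.+1.
have inb c : 31 <= c -> c < 34 -> nth 0 (corners (entry i.+1)) (c - 31) < 31.
  by move=> c31 c34; apply/e31/mem_nth => /=; lia.
case: ltnP => ha; case: ltnP => hb eqab.
- by have [] := vtx_inj (ltnW ik) (ltnW ik) ha hb eqab.
- by have [] := vtx_inj (ltnW ik) ik ha (inb _ hb b34) eqab; lia.
- by have [] := vtx_inj ik (ltnW ik) (inb _ ha a34) hb eqab; lia.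
- have [_ /eqP] := vtx_inj ik ik (inb _ ha a34) (inb _ hb b34) eqab.
  by rewrite nth_uniq//=; lia.
Qed.

Lemma block_vertex_port i (j : 'I_3) :
  block_vertex i (31 + j) = vtx i.+1 (nth 0 (corners (entry i.+1)) j).
Proof. by rewrite /block_vertex ltnNge leq_addr addKn. Qed.

Lemma block_vertex_level i v : i.+1 < k -> v < 34 ->
  (block_vertex i v).1 = (if v < 31 then i else i.+1) :> nat.
Proof.
by move=> ik v34; rewrite /block_vertex; case: ifP => _;
  rewrite vtx_level// ltnW.
Qed.

Lemma all_corners_ltn (s : seq (nat * nat * nat)) n t v :
  all (fun t => all (gtn n) (corners t)) s -> t \in s -> v \in corners t -> v <
    n.
Proof. by move=> /allP sn /sn /allP tn /tn. Qed.

Lemma block_faces_ltn t v : t \in block_faces -> v \in corners t -> v < 34.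
Proof. by apply: all_corners_ltn; vm_compute. Qed.

Lemma level_facesP i f : i < k -> f \in level_faces i ->
  if i.+1 == k then exists2 t, t \in cap_faces & f = triangle (vtx i) t
  else exists2 t, t \in block_faces & f = triangle (block_vertex i) t.
Proof. by move=> ik; rewrite /level_faces; case: ifP => _ /mapP. Qed.

(** Faces of later copies therefore touch a block only at its inner triangle, and [coordS] applies
    to all their vertices. *)
Lemma level_faces_level i f v : i < k -> f \in level_faces i -> v \in f ->
  i <= v.1.
Proof.
move=> ik /(level_facesP ik); case: ifP => iL [t ts ->];
  rewrite mem_triangle => /mapP[u ut ->].
  by rewrite vtx_level.
rewrite block_vertex_level ?(block_faces_ltn ts)//; first by case: ifP.
by rewrite ltn_neqAle iL.
Qed.

(* The rows are the vectors of the inner triangle of the block, hence [coord i]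
   is the position of the copies [j >= i] with the entry triangle of copy [i]
   at the standard basis. *)
Definition block_matrix : 'M[R]_3 :=
  \matrix_(j < 3) Zrow R (Zpt block_pts (31 + j)).

Definition base_row (i v : nat) : 'rV[R]_3 :=
  Zrow R (Zpt (if i.+1 == k then cap_pts else block_pts) v).

Definition coord (i : nat) (v : V) : 'rV[R]_3 :=
  (base_row v.1 v.2 *m block_matrix ^+ (v.1 - i))%R.

Lemma coordS i (v : V) : i < v.1 -> coord i v = (coord i.+1 v *m
  block_matrix)%R.
Proof. by move=> iv; rewrite /coord -mulmxA mulmxE -exprSr subnSK. Qed.

Lemma coord_vtx i v : i < k -> v < 31 -> coord i (vtx i v) = base_row i v.
Proof.
by move=> ik v31; rewrite /coord vtx_level// subnn expr0 mulmx1 /= inordK.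
Qed.

(** Induction on the number of copies after copy [i]: the last copy is the cap, and each earlier
    block receives the fan of its successors in its inner triangle. *)
Lemma fan_from d i : i + d.+1 = k ->
  fan (triangle (vtx i) (entry i)) (faces_from i) (coord i).
Proof.
elim: d i => [|d IHd] i ik.
  have iL : i.+1 == k by lia.
  have ik' : i < k by lia.
  rewrite {1}/entry iL; apply: (@fan_eq _ _ _ (fun f =>
    f \in [seq triangle (vtx i) t | t <- cap_faces])).
    move=> f; split=> [fi|[j ij]]; first by exists i;
      rewrite ?leqnn// /level_faces iL.
    by rewrite (_ : j = i) ?/level_faces ?iL//; lia.
  apply: (fan_of_certificate cap_certificate).
    by move=> a b a31 b31 /vtx_inj[].
  by move=> v v31; rewrite coord_vtx// /base_row iL.
have iL : (i.+1 == k) = false by lia.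
have ik' : i.+1 < k by lia.
have FI := IHd i.+1 (etrans (addSnnS _ _) ik).
pose hole := triangle (block_vertex i) (31, 32, 33).
have holeE : hole = triangle (vtx i.+1) (entry i.+1).
  by apply/eq_from_tnth => j; rewrite !tnth_triangle -block_vertex_port;
    case: j => [[|[|[|]]]].
pose K0 f := f \in [seq triangle (block_vertex i) t | t <- block_faces].
(* For the indices 31, 32, 33: the next fan has these corners at the standard basis, and
   [block_matrix] sends the basis to their points in the block. *)
have pb v : v < 34 -> coord i (block_vertex i v) = Zrow R (Zpt block_pts v).
  move=> v34; have [v31|v31] := ltnP v 31.
    by rewrite /block_vertex v31 coord_vtx ?(ltnW ik')// /base_row iL.
  have [j vE] : exists j : 'I_3, v = 31 + j.
    have v3 : v - 31 < 3 by lia.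
    by exists (Ordinal v3); rewrite /= subnKC.
  have := fan_corner FI j; rewrite tnth_triangle => pj.
  by rewrite vE block_vertex_port coordS ?vtx_level// pj -rowE rowK.
have [ub bound _] := entryP i.+1.
apply: (@fan_eq _ _ _ (fun f => K0 f \/ faces_from i.+1 f)).
  move=> f; split=> [[fK|[j ij fj]]|[j ij fj]].
  - by exists i; rewrite ?leqnn ?(ltnW ik')// /level_faces iL.
  - by exists j; [lia|].
  - have [ji|ji] := eqVneq j i; last by right; exists j; [lia|].
    by left; move: fj; rewrite ji /level_faces iL.
apply: (@fan_glue _ _ _ hole _ _ _ (coord i.+1)).
- apply: (@fan_eq _ _ _ (fun f =>
    f \in [seq triangle (block_vertex i) t | t <- (31, 32,
      33) :: block_faces])).
    move=> f; rewrite /= inE; split=> [/orP[/eqP|]|[|->]];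
      [by right|by left| |by rewrite eqxx].
    by move=> fK; apply/orP; right.
  have -> : triangle (vtx i) (entry i) = triangle (block_vertex i) (2, 19, 24).
    by rewrite /entry iL.
  apply: (fan_of_certificate block_certificate); first exact: block_vertex_inj.
  exact: pb.
- by rewrite holeE.
- move=> _ /mapP[t tB ->].
  (* No face of the block has all of 31, 32, 33 as corners. *)
  have /allP/(_ t tB)/hasP[j] : all (fun t => has (fun j =>
    31 + j \notin corners t)
    (iota 0 3)) block_faces by vm_compute.
  rewrite mem_iota => /= j3 jt; exists (Ordinal j3).
  rewrite tnth_triangle mem_triangle.
  have -> : nth 0 (corners (31, 32, 33)) (Ordinal j3) = 31 + j.
    by case: j j3 {jt} => [|[|[|]]].
  have j34 : 31 + j < 34 by lia.
  apply: contra jt => /mapP[u ut eqju].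
  by rewrite (block_vertex_inj ik' _ _ eqju) // inE (block_faces_ltn tB).
- exists ord0; rewrite tnth_triangle mem_triangle;
    apply/negP => /mapP[u _ /(congr1 (fun v : V => v.1 : nat))].
  by rewrite (block_vertex_level ik')// vtx_level ?(ltnW ik')//= => e; lia.
- move=> _ g v /mapP[t tB ->] [j ij gj];
    rewrite mem_triangle => /mapP[u ut ->] vg.
  have u34 := block_faces_ltn tB ut.
  have := level_faces_level (andP ij).2 gj vg.
  rewrite block_vertex_level//; case: ltnP => u31; first by lia.
  move=> _; rewrite mem_triangle; apply: map_f; rewrite !inE /=; lia.
- move=> f v [j ij fj] vf.
  have iv := leq_trans (andP ij).1 (level_faces_level (andP ij).2 fj vf).
  rewrite coordS//; congr (_ *m _)%R; apply/row_matrixP => l.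
  rewrite !rowK tnth_triangle pb; last by case: l => [[|[|[|]]]].
  by case: l => [[|[|[|]]]].
Qed.
End Model.

(** * The graph M_k *)

Section Combinatorics.
Variable m : nat.
Notation k := m.+2.
Notation V := ('I_k * 'I_31)%type.

Lemma T_edges_ltn u v : (u, v) \in T_edges -> [/\ u < 31, v < 31 & u != v].
Proof.
have /allP ok : all (fun e => [&& e.1 < 31, e.2 < 31 & e.1 != e.2]) T_edges.
  by vm_compute.
by move=> /ok /and3P.
Qed.

Lemma T_ends_nat (e : edge T) : exists u v, [/\ (u, v) \in T_edges,
  tnth (in_tuple T_edges) e = (u, v) & T_ends e = (inord u, inord v)].
Proof.
have := mem_tnth e (in_tuple T_edges); rewrite /T_ends.
by case: (tnth _ e) => u v uv; exists u, v; split.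
Qed.

(** The pairs formed by the smaller and the larger end of each listed edge are distinct by
    computation, and they do not see the orientation. *)
Lemma T_ends_inj (e f : edge T) :
  T_ends e = T_ends f \/ T_ends e = ((T_ends f).2, (T_ends f).1) -> e = f.
Proof.
pose nrm (e : nat * nat) := (minn e.1 e.2, maxn e.1 e.2).
have uT : uniq (map nrm T_edges) by vm_compute.
have [u [v [uv eE ->]]] := T_ends_nat e.
have [u' [v' [uv' fE ->]]] := T_ends_nat f.
have [u31 v31 _] := T_edges_ltn uv; have [u31' v31' _] := T_edges_ltn uv'.
move=> eqends; have eqn : nrm (u, v) = nrm (u', v').
  by case: eqends => /= -[/(congr1 val) + /(congr1 val)];
    rewrite /= !inordK// => -> ->; rewrite // /nrm /= minnC maxnC.
have : tnth (map_tuple nrm (in_tuple T_edges)) e =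
       tnth (map_tuple nrm (in_tuple T_edges)) f.
  by rewrite !tnth_map eE fE.
by apply: (tuple_uniqP _ _); exact: uT.
Qed.

Lemma M_ends_inl i (e : edge T) : exists u v,
  (u, v) \in T_edges /\ @M_ends k (inl (i, e)) = (vtx m i u, vtx m i v).
Proof.
have [u [v [uv _ eE]]] := T_ends_nat e; exists u, v; split=> //.
by rewrite /M_ends eE /vtx inord_val.
Qed.

Lemma T_edge_exists i u v : i < k -> (u, v) \in T_edges ->
  exists e : edge (M k), ends e = (vtx m i u, vtx m i v).
Proof.
move=> ik /(@tnthP _ _ (in_tuple T_edges))[e eE].
exists (inl (inord i, e)); rewrite /= /T_ends -eE.
by [].
Qed.

(** [entry] and [M_annulus] choose the port of the next copy by the same test, so annulus edges are
    images of fixed pairs of block indices. *)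
Lemma M_ends_inr (i : 'I_k.-1) (j : 'I_6) : @M_ends k (inr (i, j)) =
  (block_vertex m i (nth (0, 0) annulus_pairs j).1,
   block_vertex m i (nth (0, 0) annulus_pairs j).2).
Proof.
have this : this_copy i = inord i by apply/val_inj;
  rewrite /= inordK// ltnW// ltnS.
have next : next_copy i = inord i.+1 by apply/val_inj; rewrite /= inordK// ltnS.
rewrite /M_ends /M_annulus this next /block_vertex /entry.
by case: (i.+2 == k); case: j => [[|[|[|[|[|[|]]]]]]].
Qed.

Lemma annulus_edge_exists i u v : i.+1 < k -> (u, v) \in annulus_pairs ->
  exists e : edge (M k), ends e = (block_vertex m i u, block_vertex m i v).
Proof.
move=> ik uv; have j6 : index (u, v) annulus_pairs < 6 by rewrite index_mem.
exists (inr (Ordinal (ik : i < k.-1), Ordinal j6)).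
by rewrite [LHS]M_ends_inr /= nth_index.
Qed.

Lemma annulus_pairs_ltn (j : 'I_6) :
  (nth (0, 0) annulus_pairs j).1 < 31 /\
  31 <= (nth (0, 0) annulus_pairs j).2 < 34.
Proof. by case: j => [[|[|[|[|[|[|]]]]]]]. Qed.

Lemma M_inr_level (i : 'I_k.-1) (j : 'I_6) :
  (@M_ends k (inr (i, j))).1.1 = i :> nat /\
  (@M_ends k (inr (i, j))).2.1 = i.+1 :> nat.
Proof.
have [j1 /andP[j2 j3]] := annulus_pairs_ltn j.
have ik : i.+1 < k by rewrite ltnS.
rewrite M_ends_inr !block_vertex_level//; first by rewrite j1 ltnNge j2.
exact: ltn_trans j1 _.
Qed.

(** An edge of a copy stays at one level and an annulus edge goes up by exactly one, so the two
    kinds never coincide and an annulus edge is never the reverse of another. Within a copy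
    [T_ends_inj] applies; within an annulus, the pairs are distinct and [block_vertex] is
    injective. *)
Lemma M_simple : simple_graph (M k).
Proof.
split.
  case=> [[i e]|[i j]].
    have [u [v [/T_edges_ltn[u31 v31 uv] _ eE]]] := T_ends_nat e.
    suff ne : (T_ends e).1 <> (T_ends e).2 by move=> /(congr1 snd)/ne.
    by rewrite eE => /(congr1 val); rewrite /= !inordK// => /eqP;
      rewrite (negPf uv).
  have [l1 l2] := M_inr_level i j.
  by move=> /(congr1 (fun v : V => v.1 : nat)); rewrite l1 l2; lia.
have level_eq (p q : V * V) : p = q \/ p = (q.2, q.1) ->
    (p.1.1 = q.1.1 :> nat /\ p.2.1 = q.2.1 :> nat) \/
    (p.1.1 = q.2.1 :> nat /\ p.2.1 = q.1.1 :> nat).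
  by case=> ->; [left|right].
move=> e f x y je jf.
have : @M_ends k e = @M_ends k f \/
    @M_ends k e = ((@M_ends k f).2, (@M_ends k f).1).
  rewrite -[M_ends e]/(ends e) -[M_ends f]/(ends f).
  by case: je => ->; case: jf => ->; [left|right|right|left].
case: e f {je jf} => [[i e]|[i j]] [[i' e']|[i' j']].
- rewrite /M_ends => eqends; have ii : i = i' by case: eqends => -[].
  rewrite ii; congr (inl (_, _)); apply: T_ends_inj.
  case: (T_ends e) eqends => u v; case: (T_ends e') => u' v'.
  by case=> -[_ -> _ ->]; [left|right].
- have [l1 l2] := M_inr_level i' j'; move=> /level_eq; rewrite l1 l2 => lev.
  have : (i = i' :> nat /\ i = i'.+1 :> nat) \/
         (i = i'.+1 :> nat /\ i = i' :> nat) by exact: lev.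
  by lia.
- have [l1 l2] := M_inr_level i j; move=> /level_eq; rewrite l1 l2 => lev.
  have : (i = i' :> nat /\ i.+1 = i' :> nat) \/
         (i = i' :> nat /\ i.+1 = i' :> nat) by exact: lev.
  by lia.
- have [l1 l2] := M_inr_level i j; have [l1' l2'] := M_inr_level i' j'.
  move=> eqends; have := level_eq _ _ eqends; rewrite l1 l2 l1' l2'.
  case=> -[e1 e2]; last lia.
  have ii : i = i' by apply/val_inj.
  case: eqends => [|/(congr1 (fun v : V * V => v.1.1 : nat))]; last first.
    by rewrite -[LHS]/((M_ends _).1.1 : nat) l1 [RHS]l2'; lia.
  rewrite ii => eqends; congr (inr (_, _)).
  move: eqends; rewrite !M_ends_inr.
  have ik : i'.+1 < k by rewrite ltnS.
  have [j1 /andP[j2 j3]] := annulus_pairs_ltn j.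
  have [j1' /andP[j2' j3']] := annulus_pairs_ltn j'.
  move=> [] eq1 eq2.
  have eqj1 := block_vertex_inj ik (leq_trans j1 (isT : 31 <= 34))
    (leq_trans j1' (isT : 31 <= 34)) eq1.
  have eqj2 := block_vertex_inj ik j3 j3' eq2.
  have : nth (0, 0) annulus_pairs j = nth (0, 0) annulus_pairs j'.
    by apply/eqP; rewrite -pair_eqE /pair_eq eqj1 eqj2 !eqxx.
  by move/eqP; rewrite nth_uniq// => /eqP/val_inj.
Qed.

(** * Incidence of the faces of M_k with its edges and vertices *)

Lemma cap_edge u v : (u, v) \in T_edges ->
  exists2 t, t \in cap_faces & u \in corners t /\ v \in corners t.
Proof.
have /allP ok : all (fun e => has (fun t =>
  (e.1 \in corners t) && (e.2 \in corners t))
  cap_faces) T_edges by vm_compute.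
by move=> /ok /hasP[t ts /andP[]]; exists t.
Qed.

(** The sides of the two omitted ports are still covered by neighbouring faces. *)
Lemma block_edge u v : (u, v) \in T_edges ++ annulus_pairs ->
  exists2 t, t \in block_faces & u \in corners t /\ v \in corners t.
Proof.
have /allP ok : all (fun e => has (fun t =>
  (e.1 \in corners t) && (e.2 \in corners t))
  block_faces) (T_edges ++ annulus_pairs) by vm_compute.
by move=> /ok /hasP[t ts /andP[]]; exists t.
Qed.

Definition linked (E : seq (nat * nat)) u v := ((u, v) \in E) || ((v, u) \in E).

Lemma cap_face_side t u v : t \in cap_faces -> u \in corners t -> v \in corners
  t ->
  u != v -> linked T_edges u v.
Proof.
have /allP ok : all (fun t => all2rel (fun u v =>
  (u == v) || linked T_edges u v)
  (corners t)) cap_faces by vm_compute.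
move=> /ok/allrelP tok ut vt /negPf uv; have := tok u v ut vt.
by rewrite uv orFb.
Qed.

(** The last alternative is a side of the inner triangle, which is an edge of the next copy. *)
Lemma block_face_side t u v : t \in block_faces -> u \in corners t ->
  v \in corners t -> u != v ->
  [|| linked T_edges u v, linked annulus_pairs u v | (31 <= u) && (31 <= v)].
Proof.
have /allP ok : all (fun t => all2rel (fun u v => (u == v) ||
    [|| linked T_edges u v, linked annulus_pairs u v | (31 <= u) && (31 <= v)])
  (corners t)) block_faces by vm_compute.
move=> /ok/allrelP tok ut vt /negPf uv; have := tok u v ut vt.
by rewrite uv orFb.
Qed.

Lemma T_linked_joins i u v : i < k -> linked T_edges u v ->
  exists e : edge (M k), joins e (vtx m i u) (vtx m i v).
Proof.
move=> ik /orP[] /(T_edge_exists ik)[e eE]; exists e; first by left.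
by right.
Qed.

Lemma entry_joins i u v : i < k -> u \in corners (entry m i) ->
  v \in corners (entry m i) -> u != v ->
  exists e : edge (M k), joins e (vtx m i u) (vtx m i v).
Proof.
move=> ik ui vi uv; have [_ _ side] := entryP m i.
by apply: T_linked_joins => //; exact: side.
Qed.

Lemma block_joins i t u v : i.+1 < k -> t \in block_faces -> u \in corners t ->
  v \in corners t -> u != v ->
  exists e : edge (M k), joins e (block_vertex m i u) (block_vertex m i v).
Proof.
move=> ik tB ut vt uv.
have u34 := block_faces_ltn tB ut; have v34 := block_faces_ltn tB vt.
have [luv|luv|/andP[u31 v31]] := or3P (block_face_side tB ut vt uv).
- have [u31 v31] : u < 31 /\ v < 31 by case/orP: luv => /T_edges_ltn[].
  by rewrite /block_vertex u31 v31; apply: T_linked_joins => //; exact: ltnW.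
- by case/orP: luv => /(annulus_edge_exists ik)[e eE]; exists e; [left|right].
- rewrite /block_vertex (ltnNge u) (ltnNge v) u31 v31 /=.
  have [ue _ _] := entryP m i.+1.
  apply: entry_joins => //; try (by apply: mem_nth => /=; lia).
  by rewrite nth_uniq//=; lia.
Qed.

Lemma M_face_side f (x y : V) :
  @faces_from m 0 f \/ f = triangle (vtx m 0) (entry m 0) -> x \in f -> y \in f
    ->
  x != y -> exists e : edge (M k), joins e x y.
Proof.
have img (phi : nat -> V) t : x \in triangle phi t -> y \in triangle phi t ->
    x != y -> exists u v, [/\ x = phi u, y = phi v, u \in corners t,
      v \in corners t & u != v].
  rewrite !mem_triangle => /mapP[u ut ->] /mapP[v vt ->] uv; exists u, v;
    split=> //.
  by apply: contraNneq uv => ->.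
case=> [[i /andP[_ ik] /(level_facesP ik)]|->].
  case: ifP => iL [t ts ->] xt yt /(img _ _ xt yt)[u [v [-> -> ut vt uv]]].
    by apply: T_linked_joins => //; exact: cap_face_side ts ut vt uv.
  by apply: block_joins ts ut vt uv; rewrite ltn_neqAle iL.
move=> xt yt /(img _ _ xt yt)[u [v [-> -> ut vt uv]]].
exact: entry_joins.
Qed.

Lemma M_edge_in_face (e : edge (M k)) : exists2 f, @faces_from m 0 f &
  (ends e).1 \in f /\ (ends e).2 \in f.
Proof.
have inT (phi : nat -> V) t u : u \in corners t -> phi u \in triangle phi t.
  by move=> ut; rewrite mem_triangle map_f.
case: e => [[i e]|[i j]].
  have ik : i < k by [].
  have [u [v [uv eE]]] := M_ends_inl i e; rewrite [ends _]eE /=.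
  have [iL|iL] := eqVneq i.+1 k.
    have [t ts [ut vt]] := cap_edge uv.
    exists (triangle (vtx m i) t); last by rewrite !inT.
    by exists i; rewrite ?ik// /level_faces iL eqxx map_f.
  have [u31 v31 _] := T_edges_ltn uv.
  have [|t ts [ut vt]] := @block_edge u v; first by rewrite mem_cat uv.
  exists (triangle (block_vertex m i) t).
    by exists i; rewrite ?ik// /level_faces (negPf iL) map_f.
  have -> : vtx m i u = block_vertex m i u by rewrite /block_vertex u31.
  have -> : vtx m i v = block_vertex m i v by rewrite /block_vertex v31.
  by rewrite !inT.
have ik : i.+1 < k by rewrite ltnS.
rewrite [ends _]M_ends_inr /=.
have [|t ts [ut vt]] := @block_edge (nth (0, 0) annulus_pairs j).1
    (nth (0, 0) annulus_pairs j).2.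
  by rewrite mem_cat -surjective_pairing mem_nth ?orbT.
exists (triangle (block_vertex m i) t); last by rewrite !inT.
by exists i; rewrite ?(ltnW ik)// /level_faces ltn_eqF// map_f.
Qed.

Lemma M_vertex_in_face (x : V) : exists2 f, @faces_from m 0 f & x \in f.
Proof.
have vE : x = vtx m x.1 x.2 by case: x => i v; rewrite /vtx !inord_val.
have x31 : (x.2 : nat) \in iota 0 31 by rewrite mem_iota ltn_ord.
have xk : x.1 < k by rewrite ltn_ord.
have [iL|iL] := eqVneq x.1.+1 k.
  have /allP/(_ _ x31)/hasP[t ts xt] : all (fun v => has (fun t =>
    v \in corners t)
    cap_faces) (iota 0 31) by vm_compute.
  exists (triangle (vtx m x.1) t); last by rewrite {1}vE mem_triangle map_f.
  by exists (x.1 : nat); rewrite ?xk// /level_faces iL eqxx map_f.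
have /allP/(_ _ x31)/hasP[t ts xt] : all (fun v => has (fun t =>
  v \in corners t)
  block_faces) (iota 0 31) by vm_compute.
exists (triangle (block_vertex m x.1) t).
  by exists (x.1 : nat); rewrite ?xk// /level_faces (negPf iL) map_f.
have {1}-> : x = block_vertex m x.1 x.2 by rewrite /block_vertex ltn_ord.
by rewrite mem_triangle map_f.
Qed.

End Combinatorics.

Theorem lemma6p2 (R : realType) (k : nat) (hk : (2 <= k)%N) :
  [/\ simple_graph (M k), sphere_triangulation R (M k) &
      #|vertex (M k)| = (31 * k)%N].
Proof.
case: k hk => [|[|m]]// _; split.
- exact: M_simple.
- have uo : uniq (triangle (vtx m 0) (entry m 0)).
    change (uniq (map (vtx m 0) (corners (entry m 0)))).
    rewrite map_inj_in_uniq; first by have [] := entryP m 0.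
    have [_ /allP e31 _] := entryP m 0.
    by move=> a b /e31 a31 /e31 b31 /vtx_inj[].
  (* The fan from copy 0 has all faces but the outer one, which is the entry triangle of copy 0. *)
  apply: (@triangulation_of_fan R (M m.+2) _ _ _ (fan_from R (add0n _)) uo).
  + exact: M_simple.
  + exact: M_edge_in_face.
  + exact: M_face_side.
  + exact: M_vertex_in_face.
- by rewrite card_prod !card_ord mulnC.
Qed.
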